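(* Let $\sigma\in\{-1,0,1\}$, $\omega_L\vee\omega_R>0$ and $\theta_L,\theta_R\in\Theta$. For all $n\in\mathbb N$ with $n\le|V|$ and all $x_1,\dots,x_n\in V$ with $x_i\ne x_j$ if $i\neq j$, setting $\xi=\delta_{x_1}+\cdots+\delta_{x_n}$, we have $$\mathbb E_{\mu_{\theta_L,\theta_R}}\left[\prod_{i=1}^n\left(\frac{\eta(x_i)}{\alpha_{x_i}}-\bar\theta_{x_i}\right)\right]=(\theta_L-\theta_R)^n\,\psi(\xi),$$ where $$\psi(\xi)=\sum_{\zeta\le\xi}(-1)^{|\xi|-|\zeta|}\ \widehat{\mathbb P}^{\mathrm{IRW}}_{\xi-\zeta}\big((\xi-\zeta)_\infty(L)=|\xi-\zeta|\big)\ \widehat{\mathbb P}_\zeta\big(\zeta_\infty(L)=|\zeta|\big).$$ In particular $\psi(\xi)\in\mathbb R$ depends on neither $\theta_L$ nor $\theta_R$, but only on $\sigma$ and the underlying geometry (the parameters $\omega_{\{x,y\}}$, $\alpha_x$, $\omega_L,\omega_R,\alpha_L,\alpha_R$).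
   Context: Setting. $\mathbb N=\{1,2,\dots\}$, $\mathbb N_0=\mathbb N\cup\{0\}$. Let $N\in\mathbb N$, $V=\{1,\dots,N\}$. Symmetric conductances $\omega_{\{x,y\}}\in[0,\infty)$, $x,y\in V$, with $\omega_{\{x,x\}}=0$; write $x\sim y$ if $\omega_{\{x,y\}}\neq0$ and assume the graph $(V,\sim)$ is connected. Site parameters $\alpha_x\in\mathbb N$. Boundary parameters $\omega_L,\omega_R\ge0$, $\alpha_L,\alpha_R>0$. $\Theta=[0,1]$ if $\sigma=-1$ and $\Theta=[0,\infty)$ if $\sigma\in\{0,1\}$. Boundary driven process. $\mathcal X=\prod_{x\in V}\{0,\dots,\alpha_x\}$ if $\sigma=-1$, $\mathcal X=\mathbb N_0^V$ otherwise. $\{\eta_t\}$ is the Markov process on $\mathcal X$ with generator $\mathcal L=\sum_{\{x,y\}:x\sim y}\omega_{\{x,y\}}\mathcal L_{\{x,y\}}+\omega_L\mathcal L_L+\omega_R\mathcal L_R$ (sum over unordered pairs), where $\mathcal L_{\{x,y\}}f(\eta)=\eta(x)(\alpha_y+\sigma\eta(y))(f(\eta-\delta_x+\delta_y)-f(\eta))+\eta(y)(\alpha_x+\sigma\eta(x))(f(\eta-\delta_y+\delta_x)-f(\eta))$, $\mathcal L_Lf(\eta)=\eta(1)\alpha_L(1+\sigma\theta_L)(f(\eta-\delta_1)-f(\eta))+\alpha_L\theta_L(\alpha_1+\sigma\eta(1))(f(\eta+\delta_1)-f(\eta))$, $\mathcal L_Rf(\eta)=\eta(N)\alpha_R(1+\sigma\theta_R)(f(\eta-\delta_N)-f(\eta))+\alpha_R\theta_R(\alpha_N+\sigma\eta(N))(f(\eta+\delta_N)-f(\eta))$.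 For $\omega_L\vee\omega_R>0$ the process has a unique stationary measure $\mu_{\theta_L,\theta_R}$; $\mathbb E_{\mu_{\theta_L,\theta_R}}[f(\eta)]=\sum_\eta f(\eta)\mu_{\theta_L,\theta_R}(\eta)$. Dual process. $\widehat{\mathcal X}=\mathcal X\times\mathbb N_0^{\{L,R\}}$; $|\xi|=\xi(L)+\xi(R)+\sum_{x\in V}\xi(x)$. $\{\xi_t\}$ is the Markov process on $\widehat{\mathcal X}$ with generator $\widehat{\mathcal L}f(\xi)=\sum_{\{x,y\}:x\sim y}\omega_{\{x,y\}}\{\xi(x)(\alpha_y+\sigma\xi(y))(f(\xi-\delta_x+\delta_y)-f(\xi))+\xi(y)(\alpha_x+\sigma\xi(x))(f(\xi-\delta_y+\delta_x)-f(\xi))\}+\omega_L\alpha_L\xi(1)(f(\xi-\delta_1+\delta_L)-f(\xi))+\omega_R\alpha_R\xi(N)(f(\xi-\delta_N+\delta_R)-f(\xi))$. $\widehat{\mathbb P}_\zeta$ is its law started from $\zeta$; the trajectory is then written $\zeta_t$, and $\zeta_\infty$ is its (a.s. existing) limit, in which all particles sit in $\{L,R\}$. $\widehat{\mathbb P}^{\mathrm{IRW}}$ is the law of the dual process with $\sigma=0$ (independent walkers) and the same geometry. For configurations, $\zeta\le\xi$ means $\zeta\in\widehat{\mathcal X}$ and $\zeta(x)\le\xi(x)$ for all $x\in V\cup\{L,R\}$; $\xi-\zeta$ is the sitewise difference. Profile: $\bar\theta_x:=\mathbb E_{\mu_{\theta_L,\theta_R}}[\eta(x)/\alpha_x]$,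 equivalently $\bar\theta_x=\theta_R+\widehat p_\infty(\delta_x,\delta_L)(\theta_L-\theta_R)$ with $\widehat p_\infty(\delta_x,\delta_L)=\widehat{\mathbb P}_{\delta_x}(\xi_\infty=\delta_L)$. *)

(* Defs.v *)
From HB Require Import structures.
From mathcomp Require Import all_boot all_order all_algebra.
From mathcomp Require Import all_classical all_reals all_analysis.

Set Implicit Arguments.
Unset Strict Implicit.
Unset Printing Implicit Defensive.

Import Order.TTheory GRing.Theory Num.Theory.
Import numFieldNormedType.Exports.

Local Open Scope classical_set_scope.
Local Open Scope ring_scope.

(* Particle configurations over a finite set of sites form a countable set;
   they carry the discrete sigma-algebra. *)
Notation config I := {ffun I -> nat}.

HB.instance Definition _ (I : finType) := isPointed.Build (config I) 0.

HB.instance Definition _ (I : finType) :=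
  @isMeasurable.Build default_measure_display (config I) discrete_measurable
    discrete_measurable0 discrete_measurableC discrete_measurableU.

Definition delta (I : finType) (a : I) : config I :=
  [ffun b => (b == a) : nat].

(* Sitewise truncated difference.  In the generators below it is only applied
   to [delta a] with [xi a = 0] when the corresponding rate vanishes. *)
Definition csub (I : finType) (xi zeta : config I) : config I :=
  [ffun a => (xi a - zeta a)%N].

Definition cle (I : finType) (zeta xi : config I) : Prop :=
  forall a, (zeta a <= xi a)%N.

Definition csize (I : finType) (xi : config I) : nat := \sum_a xi a.

Definition jump (I : finType) (a b : I) (xi : config I) : config I :=
  csub xi (delta a) + delta b.

(* A Markov process in continuous time on the countable set [S], given by its
   laws [mp_law x] started from each [x], whose generator acts on bounded
   functions as [L].  Time is indexed by R but only times >= 0 matter, and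
   likewise only the laws started from a point of [S] matter. *)
Record markov_process (R : realType) (d : measure_display)
    (T : measurableType d) (S : set T) (L : (T -> R) -> T -> R) :=
  MarkovProcess {
  mp_display : measure_display;
  mp_Omega : measurableType mp_display;
  mp_law : T -> probability mp_Omega R;
  mp_X : R -> mp_Omega -> T;
  mp_measurable : forall t : R, 0 <= t -> measurable_fun setT (mp_X t);
  mp_state : forall (t : R) w, 0 <= t -> S (mp_X t w);
  mp_rcont : forall (t : R) w, 0 <= t ->
    \forall s \near t^'+, mp_X s w = mp_X t w;
  mp_start : forall x, S x -> mp_law x (mp_X 0 @^-1` [set x]) = 1%E;
  mp_markov : forall (x a b : T) (s t : R) (n : nat)
      (u : 'I_n -> R) (y : 'I_n -> T),
    S x -> S a -> 0 <= s -> 0 <= t -> (forall i, 0 <= u i <= s) ->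
    let past := [set w | forall i, mp_X (u i) w = y i]
                `&` mp_X s @^-1` [set a] in
    mp_law x (past `&` mp_X (s + t) @^-1` [set b]) =
    (mp_law x past * mp_law a (mp_X t @^-1` [set b]))%E;
  mp_generator : forall (x : T) (f : T -> R), S x ->
    (exists M : R, forall y, `|f y| <= M) ->
    t^-1 * (fine 'E_(mp_law x)[f \o mp_X t] - f x) @[t --> 0^'+] --> L f x
}.
Arguments mp_X {R d T S L} m.

Definition stationary (R : realType) (d : measure_display)
    (T : measurableType d) (S : set T) (L : (T -> R) -> T -> R)
    (M : markov_process S L) (mu : probability T R) : Prop :=
  mu S = 1%E /\
  forall (t : R) (A : set T), 0 <= t -> measurable A ->
    (\int[mu]_(x in S) mp_law M x (mp_X M t @^-1` A))%E = mu A.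

(* V = {1, ..., N} is encoded as 'I_m.+1 with N = m.+1, so that the sites
   1 and N are [ord0] and [ord_max] (which coincide if N = 1). *)
Record geometry (R : realType) (m : nat) := Geometry {
  omega : 'I_m.+1 -> 'I_m.+1 -> R;
  omega_ge0 : forall x y, 0 <= omega x y;
  omega_sym : forall x y, omega x y = omega y x;
  omega_diag : forall x, omega x x = 0;
  omega_connected : forall x y, connect (fun x y => omega x y != 0) x y;
  alpha : 'I_m.+1 -> nat;
  alpha_gt0 : forall x, (0 < alpha x)%N;
  omegaL : R;
  omegaR : R;
  omegaL_ge0 : 0 <= omegaL;
  omegaR_ge0 : 0 <= omegaR;
  alphaL : R;
  alphaR : R;
  alphaL_gt0 : 0 < alphaL;
  alphaR_gt0 : 0 < alphaR
}.

Definition Theta (R : realType) (sigma : int) : set R :=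
  [set theta | 0 <= theta /\ (sigma = -1 -> theta <= 1)].
Arguments Theta {R} sigma.

Section Particles.
Context {R : realType} {m : nat} (G : geometry R m) (sigma : int).

Local Notation V := 'I_m.+1.

Section Bulk.
(* [i] embeds V in the set of sites: the identity for the boundary driven
   process, [inl] for the dual process. *)
Context {I : finType} (i : V -> I).

Definition confs : set (config I) :=
  [set xi | sigma = -1 -> forall x : V, (xi (i x) <= alpha G x)%N].

Definition gen_edge (x y : V) (f : config I -> R) (xi : config I) : R :=
  (xi (i x))%:R * ((alpha G y)%:R + sigma%:~R * (xi (i y))%:R)
    * (f (jump (i x) (i y) xi) - f xi)
  + (xi (i y))%:R * ((alpha G x)%:R + sigma%:~R * (xi (i x))%:R)
    * (f (jump (i y) (i x) xi) - f xi).

(* Each unordered pair {x, y} with x ~ y is counted once, through x < y. *)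
Definition gen_bulk (f : config I -> R) (xi : config I) : R :=
  \sum_(x : V) \sum_(y : V | (x < y)%N && (omega G x y != 0))
    omega G x y * gen_edge x y f xi.

End Bulk.

Definition gen_reservoir (x : V) (a theta : R) (f : config V -> R)
    (eta : config V) : R :=
  (eta x)%:R * (a * (1 + sigma%:~R * theta))
    * (f (csub eta (delta x)) - f eta)
  + a * theta * ((alpha G x)%:R + sigma%:~R * (eta x)%:R)
    * (f (eta + delta x) - f eta).

Definition gen_bd (thetaL thetaR : R) (f : config V -> R)
    (eta : config V) : R :=
  gen_bulk id f eta
  + omegaL G * gen_reservoir ord0 (alphaL G) thetaL f eta
  + omegaR G * gen_reservoir ord_max (alphaR G) thetaR f eta.

Definition bd_process (thetaL thetaR : R) : Type :=
  markov_process (confs id) (gen_bd thetaL thetaR).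

Definition dsite : finType := (V + bool)%type.
Definition dV (x : V) : dsite := inl x.
Definition dL : dsite := inr false.
Definition dR : dsite := inr true.

Definition gen_dual (f : config dsite -> R) (xi : config dsite) : R :=
  gen_bulk dV f xi
  + omegaL G * alphaL G * (xi (dV ord0))%:R * (f (jump (dV ord0) dL xi) - f xi)
  + omegaR G * alphaR G * (xi (dV ord_max))%:R
    * (f (jump (dV ord_max) dR xi) - f xi).

Definition dual_process : Type := markov_process (confs dV) gen_dual.

(* The probability, for the process started from zeta, that
   zeta_oo(L) = |zeta|.  The state space being discrete, a trajectory
   converges to zeta_oo iff it is eventually equal to it. *)
Definition prob_all_L (M : dual_process) (zeta : config dsite) : R :=
  fine (mp_law M zeta
    [set w | exists zoo : config dsite,
       (\forall t \near +oo, mp_X M t w = zoo) /\ zoo dL = csize zeta]).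

End Particles.

Arguments dsite : clear implicits.
Arguments dV {m} x.
Arguments dL {m}.
Arguments dR {m}.

(* The sum ranges over a finite set, as zeta <= xi sitewise. *)
Definition psi_sum (R : realType) (m : nat) (G : geometry R m) (sigma : int)
    (dual : dual_process G sigma) (irw : dual_process G 0)
    (xi : config (dsite m)) : R :=
  \sum_(zeta \in [set zeta | confs G sigma dV zeta /\ cle zeta xi])
    ((-1) ^+ (csize xi - csize zeta)
     * prob_all_L irw (csub xi zeta) * prob_all_L dual zeta).

Definition profile (R : realType) (m : nat) (G : geometry R m)
    (mu : probability (config 'I_m.+1) R) (x : 'I_m.+1) : R :=
  fine 'E_mu[fun eta => ((eta x)%:R / (alpha G x)%:R)%R].

(* Main.v *)
Require Import Defs.
From HB Require Import structures.
From mathcomp Require Import all_boot all_order all_algebra finmap.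
From mathcomp Require Import all_classical all_reals all_analysis.
From mathcomp Require Import zify ring.

(* Writing [D theta xi eta] for a product over the sites of polynomials in
   [eta x] of degree [xi x], centred at [theta], times
   [(thetaL - theta)^xi(L) (thetaR - theta)^xi(R)], the generators are in duality:
   [gen_bd (D theta xi) eta = gen_dual (D theta ^~ eta) xi].

   The centring at [theta = 0] gives the moments of the stationary measure.
   A combination of the [D 0 xi], [|xi| = k], with the Green function of the
   dual process as weights has drift at most a constant minus
   [\sum_(|xi| = k) D 0 xi], so that all moments are finite; stationarity then
   extends to [E_mu (gen_bd f) = 0] for every polynomially bounded [f].

   The centring at [theta = thetaR] gives the formula.  By duality
   [xi |-> E_mu (D thetaR xi)] is harmonic for the dual process; on absorbing
   configurations it is [(thetaL - thetaR)^|xi|] if all particles are at [L] and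
   [0] otherwise.  The maximum principle identifies it with
   [(thetaL - thetaR)^|xi|] times the probability that all particles end at [L].
   It remains to expand
   [\prod_i ((eta(x_i)/alpha_(x_i) - thetaR) - (thetaL - thetaR) p_(x_i))] over
   the subsets of the particles, where [p] is the one-particle absorption
   probability, whose products are those of the independent walkers. *)

Set Implicit Arguments.
Unset Strict Implicit.
Unset Printing Implicit Defensive.

Import Order.TTheory GRing.Theory Num.Theory.
Import numFieldNormedType.Exports.

Local Open Scope classical_set_scope.
Local Open Scope ring_scope.

(** * Single-site duality functions *)

(** The records assume little: the generator is known only as the pointwise derivative at time 0 of
    bounded test functions, and nothing is said about the integrability of [mu] or the uniqueness of
    the processes. The moment functions being unbounded unless [sigma = -1], every limit is taken
    along finite sets. For the dual process these are the configurations with a fixed number of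
    particles, which are left with probability 0; for the boundary driven process they are sublevel
    sets of a coercive function, on which only one-sided inequalities are available. The two
    centrings serve opposite needs: at 0 the duality functions are nonnegative on the state space,
    as a moment bound requires; at [thetaR] every configuration with a particle at [R] gets the
    value 0, which singles out absorption at [L]. Finally [psi] must be chosen before any process is
    given, so the absorption probabilities are also shown not to depend on the process that realises
    them. *)

Section Umbral.
Context {R : realFieldType}.
Implicit Types (theta : R) (d : nat -> R).

(** If a linear functional on polynomials sends [X^j] to [d j], this is its value at
    [(X - theta)^k]; the recursion peels off one factor [X - theta]. *)
Fixpoint dshift theta (k : nat) d : R :=
  if k is k'.+1 then dshift theta k' (d \o succn) - theta * dshift theta k' d
  else d 0%N.

Lemma eq_dshift theta k d d' :
  (forall j, (j <= k)%N -> d j = d' j) -> dshift theta k d = dshift theta k d'.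
Proof.
elim: k d d' => [|k IH] d d' dd' /=; first exact: dd'.
rewrite (IH d d') => [|j jk]; last by apply: dd'; apply: leqW.
by rewrite (IH _ (d' \o succn)) // => j jk; apply: dd'.
Qed.

Lemma dshiftD theta k d d' :
  dshift theta k (fun j => d j + d' j) = dshift theta k d + dshift theta k d'.
Proof.
elim: k d d' => [|k IH] d d' //=.
by rewrite IH (_ : _ \o _ = fun j => (d \o succn) j + (d' \o succn) j) // IH; ring.
Qed.

Lemma dshiftZ theta k c d :
  dshift theta k (fun j => c * d j) = c * dshift theta k d.
Proof.
elim: k d => [|k IH] d //=.
by rewrite IH (_ : _ \o _ = fun j => c * (d \o succn) j) // IH; ring.
Qed.

Lemma dshift_succ theta k d :
  dshift theta k (d \o succn) = dshift theta k.+1 d + theta * dshift theta k d.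
Proof. by rewrite /=; ring. Qed.

(** The factor [j] on [X^j] is the operator [X d/dX], which sends [(X - theta)^k] to
    [k X (X - theta)^(k-1)]. Likewise [dshift_pred] is [d/dX]. *)
Lemma dshift_index theta k d :
  dshift theta k (fun j => j%:R * d j)
  = k%:R * (dshift theta k d + theta * dshift theta k.-1 d).
Proof.
elim: k d => [|k IH] d /=; first by rewrite !mul0r.
rewrite IH (_ : _ \o _ = fun j => j%:R * (d \o succn) j + (d \o succn) j); last first.
  by apply: funext => j /=; rewrite -[in LHS]natr1; ring.
rewrite dshiftD IH; case: k {IH} => [|k] /=; rewrite ?natr1 -?natr1; ring.
Qed.

Lemma dshift_pred theta k d :
  dshift theta k (fun j => j%:R * d j.-1) = k%:R * dshift theta k.-1 d.
Proof.
elim: k d => [|k IH] d /=; first by rewrite !mul0r.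
rewrite IH (_ : _ \o _ = fun j => j%:R * ((d \o succn) j.-1) + d j); last first.
  apply: funext => -[|j] /=; first by rewrite mul0r mul1r add0r.
  by rewrite -[in LHS]natr1; ring.
rewrite dshiftD IH; case: k {IH} => [|k] /=; rewrite -?natr1; ring.
Qed.

Lemma dshift0 k d : dshift 0 k d = d k.
Proof. by elim: k d => [|k IH] d //=; rewrite mul0r subr0 IH. Qed.

End Umbral.

Section SiteFunction.
Context {R : realFieldType} (s : R).
Hypothesis sP : [\/ s = -1, s = 0 | s = 1].

(** A rising factorial for [s = 1], the power [a^k] for [s = 0], a falling factorial for
    [s = -1]. *)
Definition rising (a k : nat) : R := \prod_(i < k) (a%:R + s * i%:R).

(** The normalisation gives this factorial moment the mean [theta^j] under the one-site equilibrium
    law of density [theta] (binomial, Poisson or negative binomial), hence the umbral reading as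
    [X^j]. *)
Definition site_moment (a n j : nat) : R := (n ^_ j)%:R / rising a j.

Definition site_fun (theta : R) (a k n : nat) : R :=
  dshift theta k (site_moment a n).

Lemma risingS a k : rising a k.+1 = rising a k * (a%:R + s * k%:R).
Proof. by rewrite /rising big_ord_recr. Qed.

Lemma rate_gt0 a k : (s = -1 -> (k < a)%N) -> (0 < a)%N -> 0 < a%:R + s * k%:R :> R.
Proof.
case: sP => -> ka a0.
- by rewrite mulN1r subr_gt0 ltr_nat ka.
- by rewrite mul0r addr0 ltr0n.
- by rewrite mul1r -natrD ltr0n addn_gt0 a0.
Qed.

Lemma rate_ge0 a k : (s = -1 -> (k <= a)%N) -> 0 <= a%:R + s * k%:R :> R.
Proof.
case: sP => -> ka.
- by rewrite mulN1r subr_ge0 ler_nat ka.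
- by rewrite mul0r addr0 ler0n.
- by rewrite mul1r -natrD ler0n.
Qed.

Lemma rising_gt0 a k : (0 < a)%N -> (s = -1 -> (k <= a)%N) -> 0 < rising a k.
Proof.
move=> a0 ka; apply: prodr_gt0 => i _; apply: rate_gt0 => // /ka; exact: leq_trans.
Qed.

Lemma rising_eq0 a k : s = -1 -> (a < k)%N -> rising a k = 0.
Proof.
move=> s1 ak; apply/eqP; rewrite /rising prodf_seq_eq0; apply/hasP.
by exists (Ordinal ak); rewrite ?mem_index_enum //= s1 mulN1r subrr.
Qed.

Lemma ffactSr (n k : nat) : (n ^_ k.+1)%:R = (n ^_ k)%:R * (n%:R - k%:R) :> R.
Proof.
have [kn|nk] := leqP k n; first by rewrite ffactnSr natrM natrB.
by rewrite !ffact_small ?mul0r // ltnW.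
Qed.

Lemma ffact_pred (n k : nat) :
  n%:R * (n.-1 ^_ k)%:R = (n%:R - k%:R) * (n ^_ k)%:R :> R.
Proof.
case: n => [|n] /=; first by rewrite mul0r ffact0n; case: k => [|k]; rewrite ?subrr ?mul0r ?mulr0.
by rewrite [RHS]mulrC -ffactSr ffactSS natrM.
Qed.

Lemma ffact_succ (n k : nat) :
  (n.+1 ^_ k)%:R = (n ^_ k)%:R + k%:R * (n ^_ k.-1)%:R :> R.
Proof.
case: k => [|k]; first by rewrite !ffactn0 mul0r addr0.
by rewrite ffactSS natrM /= ffactSr -!natr1; ring.
Qed.

Lemma site_moment_pred a n j :
  n%:R * site_moment a n.-1 j = n%:R * site_moment a n j - j%:R * site_moment a n j.
Proof. by rewrite /site_moment mulrA ffact_pred; ring. Qed.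

Lemma site_moment_succ a n j : (0 < a)%N -> (s = -1 -> (j <= a)%N) ->
  (a%:R + s * n%:R) * site_moment a n.+1 j
  = (a%:R + s * n%:R) * site_moment a n j
    + j%:R * (site_moment a n j.-1 + s * site_moment a n j).
Proof.
move=> a0 ja; rewrite /site_moment ffact_succ.
case: j ja => [|j] ja; first by rewrite !mul0r !addr0.
have := rising_gt0 a0 ja; rewrite risingS ffactSr /= => /lt0r_neq0.
by rewrite mulf_eq0 negb_or => /andP[r0 q0]; field; rewrite r0 q0.
Qed.

Lemma site_moment_rec a n j : (0 < a)%N -> (s = -1 -> (n <= a)%N) ->
  n%:R * site_moment a n j
  = a%:R * site_moment a n j.+1 + j%:R * site_moment a n j
    + s * (j%:R * site_moment a n j.+1).
Proof.
move=> a0 na.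
suff e : (a%:R + s * j%:R) * site_moment a n j.+1
         = (n%:R - j%:R) * site_moment a n j.
  rewrite [RHS](_ : _ = (a%:R + s * j%:R) * site_moment a n j.+1
                        + j%:R * site_moment a n j); last by ring.
  by rewrite e; ring.
rewrite /site_moment.
have [/andP[/eqP s1 aj]|sj] := boolP ((s == -1) && (a <= j)%N); last first.
  have ja : s = -1 -> (j < a)%N.
    by move=> s1; move: sj; rewrite s1 eqxx -ltnNge.
  have := rising_gt0 a0 ja; rewrite risingS ffactSr => /lt0r_neq0.
  by rewrite mulf_eq0 negb_or => /andP[r0 q0]; field; rewrite r0 q0.
(* Exclusion with [a <= j]: the left side is 0 by the convention [0^-1 = 0]. So is the right side:
   for [a < j] by the same convention, for [j = a] because [(n - a) n ^_ a] is [n ^_ a.+1] and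
   [n <= a]. *)
rewrite rising_eq0 // invr0 mulr0 mulr0.
move: aj; rewrite leq_eqVlt => /predU1P[aj|aj]; last first.
  by rewrite rising_eq0 // invr0 !mulr0.
rewrite mulrA -[(n%:R - j%:R) * _]mulrC -ffactSr ffact_small ?mul0r //.
by rewrite ltnS -aj na.
Qed.

(** In umbral terms, removing a particle at rate [n] acts as [- X d/dX], and adding one at rate
    [a + s n] ([site_fun_succ]) as [(1 + s X) d/dX]; both are then expanded around [theta]. *)
Lemma site_fun_pred theta a k n :
  n%:R * site_fun theta a k n.-1
  = n%:R * site_fun theta a k n
    - k%:R * (site_fun theta a k n + theta * site_fun theta a k.-1 n).
Proof.
rewrite /site_fun -dshift_index -!dshiftZ -mulN1r -dshiftZ -dshiftD.
by apply: eq_dshift => j _; rewrite site_moment_pred; ring.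
Qed.

Lemma site_fun_succ theta a k n : (0 < a)%N -> (s = -1 -> (k <= a)%N) ->
  (a%:R + s * n%:R) * site_fun theta a k n.+1
  = (a%:R + s * n%:R) * site_fun theta a k n
    + k%:R * ((1 + s * theta) * site_fun theta a k.-1 n + s * site_fun theta a k n).
Proof.
move=> a0 ka; rewrite /site_fun -!dshiftZ.
rewrite (@eq_dshift _ _ _ _ (fun j => (a%:R + s * n%:R) * site_moment a n j
   + (j%:R * site_moment a n j.-1 + s * (j%:R * site_moment a n j)))); last first.
  move=> j jk; rewrite site_moment_succ //; last by move=> /ka; apply: leq_trans.
  ring.
rewrite !dshiftD (dshift_pred theta k (site_moment a n)).
rewrite !dshiftZ dshift_index; ring.
Qed.

(* In the umbral notation [site_moment a n j = X^j] and [site_fun theta a k n =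
   (X - theta)^k]; multiplication by [n] is then [a X + (X + s X^2) d/dX]. *)
Lemma site_fun_rec theta a k n : (0 < a)%N -> (s = -1 -> (n <= a)%N) ->
  n%:R * site_fun theta a k n
  = (a%:R + s * k%:R) * site_fun theta a k.+1 n
    + (a%:R * theta + k%:R * (1 + 2 * s * theta)) * site_fun theta a k n
    + k%:R * (theta * (1 + s * theta)) * site_fun theta a k.-1 n.
Proof.
move=> a0 na; rewrite /site_fun -(dshiftZ _ _ n%:R).
rewrite (@eq_dshift _ _ _ _ (fun j => a%:R * (site_moment a n \o succn) j
   + j%:R * site_moment a n j + s * (j%:R * (site_moment a n \o succn) j))); last first.
  by move=> j jk; rewrite site_moment_rec.
rewrite !dshiftD (dshiftZ _ _ a%:R (_ \o _)) (dshiftZ _ _ s) !dshift_index !dshift_succ.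
case: k => [|k]; rewrite [_.-1]/=.
  by ring.
ring.
Qed.

Lemma site_fun0 theta a n : site_fun theta a 0 n = 1.
Proof. by rewrite /site_fun /= /site_moment /rising big_ord0 divr1. Qed.

Lemma site_fun1 theta a n : site_fun theta a 1 n = n%:R / a%:R - theta.
Proof.
rewrite /site_fun /= /site_moment /rising big_ord0 big_ord1 !ffactnS !ffactn0.
by rewrite !muln1 mulr0 addr0 divr1 mulr1.
Qed.

End SiteFunction.

(** * Duality of the generators *)

Section Configurations.
Context {I : finType}.
Implicit Types (a b c : I) (xi zeta : config I).

Lemma jumpE a b xi c : jump a b xi c = (xi c - (c == a) + (c == b))%N.
Proof. by rewrite /jump !ffunE. Qed.

Lemma csubE xi zeta c : csub xi zeta c = (xi c - zeta c)%N.
Proof. by rewrite ffunE. Qed.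

Lemma addcE xi zeta c : (xi + zeta) c = (xi c + zeta c)%N.
Proof. by rewrite ffunE. Qed.

Lemma deltaE a c : delta a c = (c == a).
Proof. by rewrite ffunE. Qed.

Lemma jump_src a b xi : a != b -> jump a b xi a = (xi a).-1.
Proof. by rewrite jumpE eqxx => /negPf->; rewrite addn0 subn1. Qed.

Lemma jump_dst a b xi : a != b -> jump a b xi b = (xi b).+1.
Proof. by rewrite jumpE eqxx eq_sym => /negPf->; rewrite subn0 addn1. Qed.

Lemma jump_other a b xi c : c != a -> c != b -> jump a b xi c = xi c.
Proof. by rewrite jumpE => /negPf-> /negPf->; rewrite subn0 addn0. Qed.

Lemma csizeD xi zeta : csize (xi + zeta) = (csize xi + csize zeta)%N.
Proof. by rewrite /csize -big_split; apply: eq_bigr => c _; rewrite addcE. Qed.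

Lemma csize_delta a : csize (delta a) = 1%N.
Proof.
rewrite /csize (bigD1 a) //= deltaE eqxx big1 ?addn0 // => c /negPf ca.
by rewrite deltaE ca.
Qed.

Lemma csubK xi zeta : cle zeta xi -> csub xi zeta + zeta = xi.
Proof. by move=> le; apply/ffunP => c; rewrite addcE csubE subnK. Qed.

Lemma delta_le a xi : (0 < xi a)%N -> cle (delta a) xi.
Proof. by move=> xa c; rewrite deltaE; case: eqP => // ->. Qed.

Lemma csize_jump a b xi : (0 < xi a)%N -> csize (jump a b xi) = csize xi.
Proof.
move=> /delta_le/csubK {2}<-; rewrite /jump !csizeD !csize_delta //.
Qed.

Lemma csize_ge a xi : (xi a <= csize xi)%N.
Proof. by rewrite /csize (bigD1 a) //= leq_addr. Qed.

End Configurations.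

(* With [d] at index [k] and [d0], [d1] at [k - 1], [k + 1], and with [dm], [dp]
   the values of [d] at [n - 1], [n + 1]; likewise for [e], [l], [m]. *)
Lemma edge_identity (R : comRingType) (s t n a k d d0 d1 dm dp m b l e e0 e1 em ep : R) :
  n * dm = n * d - k * (d + t * d0) ->
  (a + s * n) * dp = (a + s * n) * d + k * ((1 + s * t) * d0 + s * d) ->
  n * d = (a + s * k) * d1 + (a * t + k * (1 + 2 * s * t)) * d
          + k * (t * (1 + s * t)) * d0 ->
  m * em = m * e - l * (e + t * e0) ->
  (b + s * m) * ep = (b + s * m) * e + l * ((1 + s * t) * e0 + s * e) ->
  m * e = (b + s * l) * e1 + (b * t + l * (1 + 2 * s * t)) * e
          + l * (t * (1 + s * t)) * e0 ->
  n * (b + s * m) * (dm * ep - d * e) + m * (a + s * n) * (dp * em - d * e)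
  = k * (b + s * l) * (d0 * e1 - d * e) + l * (a + s * k) * (d1 * e0 - d * e).
Proof.
move=> h1 h2 h3 h4 h5 h6.
transitivity ((n * dm) * ((b + s * m) * ep) + (m * em) * ((a + s * n) * dp)
  - n * (b + s * m) * (d * e) - m * (a + s * n) * (d * e)); first by ring.
rewrite h1 h2 h4 h5.
(* The leading terms cancel, and [n], [m] survive only in the products [n * d] and [m * e], which
   the three-term recursions [h3] and [h6] eliminate. *)
transitivity ((n * d) * (l * ((1 + s * t) * e0 + s * e))
   - k * (d + t * d0) * (b * e + s * (m * e) + l * ((1 + s * t) * e0 + s * e))
   + (m * e) * (k * ((1 + s * t) * d0 + s * d))
   - l * (e + t * e0) * (a * d + s * (n * d) + k * ((1 + s * t) * d0 + s * d))).
  by ring.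
rewrite h3 h6; ring.
Qed.

Section Particles.
Context {R : realType} {m : nat} (G : geometry R m) (sigma : int).
Hypothesis sigmaP : sigma \in [:: -1; 0; 1 : int].
Local Notation V := 'I_m.+1.
Local Notation s := (sigma%:~R : R).

Lemma intr_sigmaP : [\/ s = -1, s = 0 | s = 1].
Proof.
move: sigmaP; rewrite !inE => /or3P[]/eqP->.
- by constructor 1; rewrite rmorphN1.
- by constructor 2.
- by constructor 3.
Qed.

Lemma intr_sigmaN1 : s = -1 -> sigma = -1.
Proof. by move=> e; apply: (@intr_inj R); rewrite e rmorphN1. Qed.

Definition bulk_rate (I : finType) (i : V -> I) (xy : V * V) (xi : config I) : R :=
  omega G xy.1 xy.2 *
  ((xi (i xy.1))%:R * ((alpha G xy.2)%:R + s * (xi (i xy.2))%:R)).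

(** Ordered pairs turn the generator into a sum over jumps, one rate each. The diagonal and the
    non-adjacent pairs can be included because [omega] vanishes there. *)
Lemma gen_bulkE (I : finType) (i : V -> I) (f : config I -> R) xi :
  gen_bulk G sigma i f xi =
  \sum_xy bulk_rate i xy xi * (f (jump (i xy.1) (i xy.2) xi) - f xi).
Proof.
pose A x y : R := bulk_rate i (x, y) xi * (f (jump (i x) (i y) xi) - f xi).
rewrite -(pair_big xpredT xpredT A) /=.
transitivity (\sum_(x : V) \sum_(y : V | (x < y)%N) (A x y + A y x)).
  apply: eq_bigr => x _; rewrite big_mkcondr; apply: eq_bigr => y _ /=.
  rewrite /A /bulk_rate /= (omega_sym G y x) /gen_edge.
  by case: eqP => [->|_] /=; [rewrite !mul0r addr0 | ring].
transitivity (\sum_(x : V) \sum_(y : V | (x < y)%N) A x y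
              + \sum_(x : V) \sum_(y : V | (y < x)%N) A x y).
  rewrite [X in _ + X](exchange_big_dep xpredT) //= -big_split /=.
  by apply: eq_bigr => x _; rewrite -big_split.
rewrite -big_split /=; apply: eq_bigr => x _.
have A0 : A x x = 0 by rewrite /A /bulk_rate /= omega_diag !mul0r.
rewrite [RHS](bigD1 x) //= A0 add0r.
rewrite [RHS](bigID (fun y : V => (x < y)%N)) /=; congr (_ + _); apply: eq_bigl => y;
  by rewrite -(inj_eq val_inj) /=; case: ltngtP.
Qed.

Section Duality.
Variables (thetaL thetaR theta : R).

Definition dual_fun (xi : config (dsite m)) (eta : config V) : R :=
  (\prod_(x : V) site_fun s theta (alpha G x) (xi (dV x)) (eta x))
  * ((thetaL - theta) ^+ xi dL * (thetaR - theta) ^+ xi dR).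

Let X (x : V) k n := site_fun s theta (alpha G x) k n.

Lemma dual_edge (x y : V) (xi : config (dsite m)) (eta : config V) : x != y ->
  confs G sigma (@dV m) xi -> confs G sigma id eta ->
  gen_edge G sigma id x y (dual_fun xi) eta
  = gen_edge G sigma (@dV m) x y (dual_fun ^~ eta) xi.
Proof.
move=> xy Sxi Seta.
have kx (z : V) : s = -1 -> (xi (dV z) <= alpha G z)%N by move/intr_sigmaN1/Sxi; apply.
have nx (z : V) : s = -1 -> (eta z <= alpha G z)%N by move/intr_sigmaN1/Seta; apply.
pose P := (\prod_(z | (z != x) && (z != y)) X z (xi (dV z)) (eta z))
   * ((thetaL - theta) ^+ xi dL * (thetaR - theta) ^+ xi dR).
have split (xi' : config (dsite m)) (eta' : config V) :
    (forall c : dsite m, c != dV x -> c != dV y -> xi' c = xi c) ->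
    (forall z, z != x -> z != y -> eta' z = eta z) ->
  dual_fun xi' eta' = X x (xi' (dV x)) (eta' x) * X y (xi' (dV y)) (eta' y) * P.
  move=> hxi heta; rewrite /dual_fun /P (bigD1 x) //= (bigD1 y) 1?eq_sym //=.
  rewrite !(hxi dL, hxi dR) // !mulrA; congr (_ * _ * _); congr (_ * _).
  by apply: eq_bigr => z /andP[zx zy]; rewrite hxi ?heta.
have yx : y != x by rewrite eq_sym.
have dxy : dV x != dV y :> dsite m by [].
have dyx : dV y != dV x :> dsite m by [].
rewrite /gen_edge !split //; do ?[by move=> *; apply: jump_other].
rewrite !(jump_src, jump_dst) //.
have := edge_identity (site_fun_pred s theta (alpha G x) (xi (dV x)) (eta x))
  (site_fun_succ intr_sigmaP theta (eta x) (alpha_gt0 G x) (kx x))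
  (site_fun_rec intr_sigmaP theta (xi (dV x)) (alpha_gt0 G x) (nx x))
  (site_fun_pred s theta (alpha G y) (xi (dV y)) (eta y))
  (site_fun_succ intr_sigmaP theta (eta y) (alpha_gt0 G y) (kx y))
  (site_fun_rec intr_sigmaP theta (xi (dV y)) (alpha_gt0 G y) (nx y)).
rewrite /X -!(mulrBl P) ![_ * (_ * P)]mulrA -!(mulrDl _ _ P) => <- //.
Qed.

(** In umbral terms the reservoir acts as [a (th - X) d/dX], the terms in [s] cancelling. On
    [(X - theta)^k] this gives [a k] times [(th - theta) (X - theta)^(k-1) - (X - theta)^k]: a
    factor of the site is traded for a factor of the reservoir. *)
Lemma dual_reservoir (x : V) (b : bool) (a th : R) xi eta :
  confs G sigma (@dV m) xi ->
  th = (if b then thetaR else thetaL) ->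
  gen_reservoir G sigma x a th (dual_fun xi) eta
  = a * (xi (dV x))%:R
    * (dual_fun (jump (dV x) (inr b) xi) eta - dual_fun xi eta).
Proof.
move=> Sxi thE.
have kx : s = -1 -> (xi (dV x) <= alpha G x)%N by move/intr_sigmaN1/Sxi; apply.
pose P := (\prod_(z | z != x) X z (xi (dV z)) (eta z)).
pose Q := (thetaL - theta) ^+ xi dL * (thetaR - theta) ^+ xi dR.
have split (eta' : config V) : (forall z, z != x -> eta' z = eta z) ->
    dual_fun xi eta' = X x (xi (dV x)) (eta' x) * P * Q.
  move=> heta; rewrite /dual_fun (bigD1 x) //=; congr (_ * _ * _).
  by apply: eq_bigr => z zx; rewrite heta.
have -> : dual_fun (jump (dV x) (inr b) xi) eta =
    X x (xi (dV x)).-1 (eta x) * P * ((th - theta) * Q).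
  rewrite /dual_fun (bigD1 x) //= jump_src // -/(X _ _ _); congr (_ * _ * _).
    by apply: eq_bigr => z zx; rewrite jump_other // (inj_eq (@inl_inj _ _)).
  by rewrite /Q !jumpE thE; case: b {thE} => /=; rewrite !subn0 ?addn0 addn1 exprS; ring.
rewrite /gen_reservoir !split //; last 2 first.
- by move=> z zx; rewrite addcE deltaE (negPf zx) addn0.
- by move=> z zx; rewrite csubE deltaE (negPf zx) subn0.
rewrite csubE addcE deltaE eqxx subn1 addn1.
have h1 := site_fun_pred s theta (alpha G x) (xi (dV x)) (eta x).
have h2 := site_fun_succ intr_sigmaP theta (eta x) (alpha_gt0 G x) kx.
rewrite /X.
set dm := site_fun _ _ _ _ (eta x).-1 in h1 *.
set dp := site_fun _ _ _ _ (eta x).+1 in h2 *.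
set d := site_fun _ _ _ (xi (dV x)) (eta x) in h1 h2 *.
set d0 := site_fun _ _ _ _ (eta x) in h1 h2 *.
rewrite -!mulrBl -/X.
transitivity (a * ((1 + s * th) * ((eta x)%:R * dm - (eta x)%:R * d)
   + th * (((alpha G x)%:R + s * (eta x)%:R) * dp
          - ((alpha G x)%:R + s * (eta x)%:R) * d)) * (P * Q)); first by ring.
rewrite h1 h2; ring.
Qed.

Lemma duality xi eta : confs G sigma (@dV m) xi -> confs G sigma id eta ->
  gen_bd G sigma thetaL thetaR (dual_fun xi) eta
  = gen_dual G sigma (dual_fun ^~ eta) xi.
Proof.
move=> Sxi Seta; rewrite /gen_bd /gen_dual; congr (_ + _ + _).
- apply: eq_bigr => x _; apply: eq_bigr => y /andP[xy _].
  by rewrite dual_edge // -(inj_eq val_inj) neq_ltn xy.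
- by rewrite (@dual_reservoir _ false) // !mulrA.
- by rewrite (@dual_reservoir _ true) // !mulrA.
Qed.

End Duality.
End Particles.

(** * Maximum principle and Green function of the dual process *)

Lemma finite_csize_le (I : finType) k :
  finite_set [set xi : config I | (csize xi <= k)%N].
Proof.
apply: (@sub_finite_set _ _ ((fun g : {ffun I -> 'I_k.+1} =>
   [ffun a => val (g a)] : config I) @` setT)); last first.
  by apply: finite_image; apply: finite_finset.
move=> xi /= xik; exists [ffun a => inord (xi a)] => //.
by apply/ffunP => a; rewrite !ffunE inordK // ltnS (leq_trans (csize_ge a xi)).
Qed.

(** Such a matrix is monotone: the hypothesis applied to [v] and [- v] makes it injective, and
    applied to the columns of the inverse it makes the inverse nonnegative. The witness [c] consists
    of the column sums of the inverse. *)
Lemma nonneg_left_solution (R : realFieldType) (T : finType) (A : T -> T -> R) :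
  (forall v : T -> R, (forall x, 0 <= \sum_y A x y * v y) -> forall x, 0 <= v x) ->
  exists c : T -> R, (forall x, 0 <= c x) /\ forall y, \sum_x c x * A x y = 1.
Proof.
move=> mp; pose M : 'M[R]_#|T| := \matrix_(i, j) A (enum_val i) (enum_val j).
have mpM (v : 'cV_#|T|) : (forall i, 0 <= (M *m v) i 0) -> forall i, 0 <= v i 0.
  move=> Mv i; rewrite -(enum_valK i).
  apply: (mp (fun t => v (enum_rank t) 0)) => x.
  move: (Mv (enum_rank x)); rewrite mxE (reindex (@enum_val T T)) /=; last first.
    by exists enum_rank => t _; rewrite ?enum_valK ?enum_rankK.
  by under eq_bigr => j _ do rewrite mxE enum_rankK -{2}(enum_valK j).
have Mu : M \in unitmx.
  rewrite -unitmx_tr -row_free_unit; apply: inj_row_free => v vM0.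
  have Mv0 : M *m v^T = 0 by rewrite -(trmxK M) -trmx_mul vM0 trmx0.
  apply/rowP => i; apply/eqP; rewrite mxE eq_le; apply/andP; split.
    rewrite -oppr_ge0; have := mpM (- v^T) _ i; rewrite !mxE; apply => j.
    by rewrite mulmxN Mv0 oppr0 mxE.
  by have := mpM (v^T) _ i; rewrite !mxE; apply => j; rewrite Mv0 mxE.
have Mi_ge0 i j : 0 <= invmx M i j.
  have := mpM (col j (invmx M)) _ i; rewrite mxE; apply => l.
  by rewrite colE mulmxA mulmxV // mul1mx mxE ler0n.
pose c : 'rV_#|T| := const_mx 1 *m invmx M.
exists (fun t => c 0 (enum_rank t)); split=> [t|t].
  by rewrite mxE sumr_ge0 // => i _; rewrite mxE mul1r.
have <- : (c *m M) 0 (enum_rank t) = 1 by rewrite mulmxKV // mxE.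
rewrite [RHS]mxE (reindex (@enum_val T T)) /=; last first.
  by exists enum_rank => x _; rewrite ?enum_valK ?enum_rankK.
by apply: eq_bigr => j _; rewrite [M _ _]mxE enum_valK enum_rankK.
Qed.

Section JumpGenerator.
Context {R : realType} {T : Type} {J : finType} (r : J -> T -> R) (tau : J -> T -> T).

Definition jump_gen (f : T -> R) (x : T) : R :=
  \sum_j r j x * (f (tau j x) - f x).

Lemma jump_gen_sum (K : Type) (s : seq K) (P : pred K) (c : K -> R) (F : K -> T -> R) x :
  jump_gen (fun z => \sum_(k <- s | P k) c k * F k z) x
  = \sum_(k <- s | P k) c k * jump_gen (F k) x.
Proof.
rewrite /jump_gen; under [RHS]eq_bigr => k _ do rewrite mulr_sumr.
rewrite exchange_big /=; apply: eq_bigr => j _.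
rewrite -sumrB mulr_sumr; apply: eq_bigr => k _; ring.
Qed.

Lemma jump_genD f g x : jump_gen (fun z => f z + g z) x = jump_gen f x + jump_gen g x.
Proof. by rewrite /jump_gen -big_split; apply: eq_bigr => j _ /=; ring. Qed.

Lemma jump_genZ c f x : jump_gen (fun z => c * f z) x = c * jump_gen f x.
Proof. by rewrite /jump_gen mulr_sumr; apply: eq_bigr => j _ /=; ring. Qed.

Lemma jump_gen_cst c x : jump_gen (fun=> c) x = 0.
Proof. by rewrite /jump_gen big1 // => j _; rewrite subrr mulr0. Qed.

Lemma le_jump_gen f g x : (forall j, 0 <= r j x) -> f x = g x ->
  (forall z, f z <= g z) -> jump_gen f x <= jump_gen g x.
Proof.
move=> r0 fg le; apply: ler_sum => j _; apply: ler_wpM2l => //.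
by rewrite fg lerD2r.
Qed.

Lemma eq_jump_gen f g x : f x = g x ->
  (forall j, r j x != 0 -> f (tau j x) = g (tau j x)) -> jump_gen f x = jump_gen g x.
Proof.
move=> fg le; apply: eq_bigr => j _; rewrite fg.
by have [->|/le->//] := eqVneq (r j x) 0; rewrite !mul0r.
Qed.

End JumpGenerator.

Section Dual.
Context {R : realType} {m : nat} (G : geometry R m) (sigma : int).
Hypothesis sigmaP : sigma \in [:: -1; 0; 1 : int].
Local Notation V := 'I_m.+1.
Local Notation s := (sigma%:~R : R).
Local Notation dconfig := (config (dsite m)).

Definition exit (b : bool) : V := if b then ord_max else ord0.

Definition exit_rate (b : bool) : R :=
  if b then omegaR G * alphaR G else omegaL G * alphaL G.

Definition dual_rate (j : V * V + bool) (xi : dconfig) : R :=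
  match j with
  | inl xy => bulk_rate G sigma (@dV m) xy xi
  | inr b => exit_rate b * (xi (dV (exit b)))%:R
  end.

Definition dual_jump (j : V * V + bool) (xi : dconfig) : dconfig :=
  match j with
  | inl xy => jump (dV xy.1) (dV xy.2) xi
  | inr b => jump (dV (exit b)) (inr b) xi
  end.

Lemma gen_dualE f xi :
  gen_dual G sigma f xi = jump_gen dual_rate dual_jump f xi.
Proof.
rewrite /jump_gen big_sumType /= big_bool /= [X in _ + X]addrC addrA.
by rewrite /gen_dual gen_bulkE.
Qed.

Lemma exit_rate_ge0 b : 0 <= exit_rate b.
Proof.
by case: b; rewrite mulr_ge0 ?omegaR_ge0 ?omegaL_ge0 // ltW ?alphaR_gt0 ?alphaL_gt0.
Qed.

Lemma bulk_rate_ge0 (I : finType) (i : V -> I) xy (xi : config I) :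
  confs G sigma i xi -> 0 <= bulk_rate G sigma i xy xi.
Proof.
move=> Sxi; rewrite /bulk_rate mulr_ge0 ?omega_ge0 // mulr_ge0 ?ler0n //.
apply: rate_ge0; first exact: intr_sigmaP.
by move=> /intr_sigmaN1/Sxi.
Qed.

Lemma bulk_rate_confs (I : finType) (i : V -> I) xy (xi : config I) :
  injective i ->
  confs G sigma i xi -> bulk_rate G sigma i xy xi != 0 ->
  [/\ (0 < xi (i xy.1))%N, xy.1 != xy.2 & confs G sigma i (jump (i xy.1) (i xy.2) xi)].
Proof.
case: xy => x y iI Sxi; rewrite /bulk_rate /= !mulf_eq0 !negb_or => /and3P[w x0 y0].
have xy : x != y by apply: contraNneq w => ->; rewrite omega_diag.
split=> //; first by rewrite lt0n; apply: contraNneq x0 => ->.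
move=> s1; have {}Sxi := Sxi s1; move: y0; rewrite s1 rmorphN1 mulN1r subr_eq0 eqr_nat => y0.
move=> z; rewrite jumpE !(inj_eq iI); have [->|_] := eqVneq z x.
  by rewrite (negPf xy) addn0 (leq_trans _ (Sxi x)) // leq_subr.
rewrite subn0; have [->|_] := eqVneq z y; last by rewrite addn0.
by rewrite addn1 ltn_neqAle eq_sym y0 Sxi.
Qed.

Lemma dual_rate_ge0 j xi : confs G sigma (@dV m) xi -> 0 <= dual_rate j xi.
Proof.
move=> Sxi; case: j => [xy|b] /=; first exact: bulk_rate_ge0.
by rewrite mulr_ge0 ?exit_rate_ge0.
Qed.

(** The dual dynamics conserve the number of particles, so a level is a finite invariant set, on
    which the generator is a matrix. *)
Definition level (k : nat) : set dconfig :=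
  [set xi | confs G sigma (@dV m) xi /\ csize xi = k].

Definition bulk (xi : dconfig) : nat := \sum_(x : V) xi (dV x).

Lemma csize_bulk xi : csize xi = (bulk xi + xi dL + xi dR)%N.
Proof. by rewrite /csize big_sumType /= big_bool /= -addnA [(_ dL + _)%N]addnC. Qed.

Lemma finite_level k : finite_set (level k).
Proof.
by apply: sub_finite_set (finite_csize_le _ k) => xi /= [_ ->].
Qed.

Lemma in_fset_level k xi : (xi \in fset_set (level k)) = (xi \in level k).
Proof. by rewrite in_fset_set //; apply: finite_level. Qed.

Lemma bulk0_site xi x : bulk xi = 0%N -> xi (dV x) = 0%N.
Proof. by move=> /eqP; rewrite sum_nat_eq0 => /forallP/(_ x)/eqP. Qed.

Lemma dual_jump_level k j xi : level k xi -> dual_rate j xi != 0 ->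
  level k (dual_jump j xi).
Proof.
move=> [Sxi <-]; case: j => [xy|b] /=.
  move=> /(bulk_rate_confs (@inl_inj _ _) Sxi)[x0 _ Sj].
  by split; rewrite // csize_jump.
rewrite mulf_eq0 negb_or pnatr_eq0 -lt0n => /andP[_ x0]; split; last by rewrite csize_jump.
move=> s1 x; rewrite jumpE /= addn0 (leq_trans (leq_subr _ _)) //; exact: Sxi.
Qed.

Hypothesis omegaLR_gt0 : 0 < Num.max (omegaL G) (omegaR G).

Lemma exists_exit : exists b, 0 < exit_rate b.
Proof.
move: omegaLR_gt0; rewrite lt_max => /orP[h|h].
- by exists false; rewrite mulr_gt0 ?alphaL_gt0.
- by exists true; rewrite mulr_gt0 ?alphaR_gt0.
Qed.

Lemma bulk_exit b (xi : dconfig) : (0 < xi (dV (exit b)))%N ->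
  (bulk (jump (dV (exit b)) (inr b) xi) < bulk xi)%N.
Proof.
move=> x0; rewrite /bulk (bigD1 (exit b)) //= [X in (_ < X)%N](bigD1 (exit b)) //=.
rewrite jump_src // -ltnS -addSn prednK // ltnS.
rewrite leq_add2l; apply: leq_sum => y ye.
by rewrite jump_other // (inj_eq (@inl_inj _ _)).
Qed.

(* Among the maximizers take those with fewest particles in the bulk.  They are
   preserved by the bulk jumps, so that every site is occupied in one of them;
   letting a particle exit then contradicts minimality. *)
Lemma max_principle k (g : dconfig -> R) :
  (forall xi, level k xi -> (0 < bulk xi)%N -> 0 <= gen_dual G sigma g xi) ->
  (forall xi, level k xi -> bulk xi = 0%N -> g xi <= 0) ->
  forall xi, level k xi -> g xi <= 0.
Proof.
move=> sub bdry xi0 lxi0; rewrite leNgt; apply/negP => gpos.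
pose K := fset_set (level k).
have KP xi : (xi \in K) = (xi \in level k) := in_fset_level k xi.
have K0 : xi0 \in K by rewrite KP in_setE.
pose tm := [arg max_(t > [` K0]%fset) g (val t)]%O.
pose M := g (val tm).
have gM xi : level k xi -> g xi <= M.
  move=> lxi; have Kxi : xi \in K by rewrite KP in_setE.
  by rewrite /M /tm; case: arg_maxP => // t _ /(_ [` Kxi]%fset isT).
have M0 : 0 < M by apply: lt_le_trans gpos (gM _ lxi0).
have ltm : level k (val tm) by have := valP tm; rewrite KP in_setE.
pose P b := [exists t : K, (g (val t) == M) && (bulk (val t) == b)].
have exP : exists b, P b by exists (bulk (val tm)); apply/existsP; exists tm; rewrite !eqxx.
case: (ex_minnP exP) => b0 /existsP[t1 /andP[/eqP gt1 /eqP bt1]] minb.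
pose B xi := [/\ level k xi, g xi = M & bulk xi = b0].
have B1 : B (val t1) by split=> //; have := valP t1; rewrite KP in_setE.
have b0_gt0 : (0 < b0)%N.
  rewrite lt0n; apply/eqP => b00; have [l1 _ b1] := B1.
  by have := bdry _ l1; rewrite gt1 b1 => /(_ b00); rewrite leNgt M0.
have stepg xi j : B xi -> dual_rate j xi != 0 ->
    [/\ level k (dual_jump j xi), g (dual_jump j xi) = M
      & (b0 <= bulk (dual_jump j xi))%N].
  move=> [lxi gxi bxi] rj; have lj := dual_jump_level lxi rj.
  have gj : g (dual_jump j xi) = M.
    have := sub _ lxi; rewrite bxi gen_dualE => /(_ b0_gt0).
    rewrite -oppr_le0 -sumrN => le0.
    have t0 i : 0 <= - (dual_rate i xi * (g (dual_jump i xi) - g xi)).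
      have [->|ri] := eqVneq (dual_rate i xi) 0; first by rewrite mul0r oppr0.
      rewrite -mulrN mulr_ge0 ?dual_rate_ge0 //; first by case: lxi.
      by rewrite oppr_ge0 subr_le0 gxi gM //; apply: dual_jump_level lxi ri.
    have /eqP : \sum_i - (dual_rate i xi * (g (dual_jump i xi) - g xi)) = 0.
      by apply/eqP; rewrite eq_le le0 sumr_ge0.
    rewrite psumr_eq0 => [/allP/(_ j (mem_index_enum _))/=|i _]; last exact: t0.
    by rewrite oppr_eq0 mulf_eq0 (negPf rj) subr_eq0 gxi => /eqP.
  split=> //; apply: minb; apply/existsP.
  have Kj : dual_jump j xi \in K by rewrite KP in_setE.
  by exists [` Kj]%fset; rewrite /= gj !eqxx.
pose occ x := exists2 xi, B xi & (0 < xi (dV x))%N.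
have occ_step x y : occ x -> omega G x y != 0 -> occ y.
  move=> [xi Bxi x0] w; have [y0|] := posnP (xi (dV y)); last by exists xi.
  have xy : x != y by apply: contraNneq w => ->; rewrite omega_diag.
  (* The target [y] is empty, so the rate is positive for every [sigma], exclusion included. *)
  have rj : dual_rate (inl (x, y)) xi != 0.
    rewrite /= /bulk_rate /= y0 mulr0 addr0 !mulf_neq0 // pnatr_eq0 -lt0n //.
    exact: alpha_gt0.
  have [lj gj bj] := stepg _ _ Bxi rj.
  exists (dual_jump (inl (x, y)) xi); last by rewrite /= jump_dst.
  split=> //; have [lxi _ <-] := Bxi; apply/eqP.
  have := csize_bulk (dual_jump (inl (x, y)) xi).
  rewrite (_ : csize _ = csize xi) /=; last by rewrite csize_jump.
  rewrite csize_bulk !jump_other // => /eqP; rewrite !eqn_add2r => /eqP->//.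
have [x occx] : exists x, occ x.
  have [l1 _ b1] := B1; move: b0_gt0; rewrite -b1 /bulk lt0n sum_nat_eq0.
  by move=> /forallPn[x /=]; rewrite -lt0n => x0; exists x; exists (val t1).
have [b eb] := exists_exit.
have [xi Bxi xe] : occ (exit b).
  have /connectP[p pp ->] := omega_connected G x (exit b).
  elim: p x pp occx => [|y p IH] x //= /andP[xy pp] occx; apply: IH pp _; exact: occ_step xy.
have rj : dual_rate (inr b) xi != 0.
  by rewrite /= mulf_neq0 ?gt_eqF // ltr0n.
have [_ _ ] := stepg _ _ Bxi rj.
have [_ _ <-] := Bxi; by rewrite leqNgt bulk_exit.
Qed.

Lemma eq_gen_dual k f g xi : level k xi -> (forall z, level k z -> f z = g z) ->
  gen_dual G sigma f xi = gen_dual G sigma g xi.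
Proof.
move=> lxi fg; rewrite !gen_dualE; apply: eq_jump_gen => [|j rj]; apply: fg => //.
exact: dual_jump_level.
Qed.

Lemma harmonic_unique k (f g : dconfig -> R) :
  (forall xi, level k xi -> (0 < bulk xi)%N ->
     gen_dual G sigma f xi = gen_dual G sigma g xi) ->
  (forall xi, level k xi -> bulk xi = 0%N -> f xi = g xi) ->
  forall xi, level k xi -> f xi = g xi.
Proof.
move=> hfg bfg.
have le (u v : dconfig -> R) :
  (forall xi, level k xi -> (0 < bulk xi)%N ->
     gen_dual G sigma u xi = gen_dual G sigma v xi) ->
  (forall xi, level k xi -> bulk xi = 0%N -> u xi = v xi) ->
  forall xi, level k xi -> u xi <= v xi.
  move=> huv buv xi lxi; rewrite -subr_le0.
  apply: (@max_principle k (fun z => u z - v z)) => // z lz bz; last by rewrite buv ?subrr.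
  have -> : (fun z => u z - v z) = (fun z => u z + -1 * v z).
    by apply: funext => y; rewrite mulN1r.
  by rewrite gen_dualE jump_genD jump_genZ -!gen_dualE huv // mulN1r subrr.
by move=> xi lxi; apply/eqP; rewrite eq_le !le // => z lz bz; rewrite ?hfg ?bfg.
Qed.

(* [c] is a Green function: the row vector [c] solves [c (- L) = 1] off the
   absorbing configurations, for the generator [L] on [level k]. *)
Lemma green_weights k : exists c : dconfig -> R, (forall xi, 0 <= c xi) /\
  forall D : dconfig -> R,
  \sum_(xi <- fset_set (level k) | (0 < bulk xi)%N) c xi * gen_dual G sigma D xi
  = \sum_(xi <- fset_set (level k) | bulk xi == 0%N) c xi * D xi
    - \sum_(xi <- fset_set (level k)) D xi.
Proof.
set K := fset_set (level k).
have KP xi : (xi \in K) = (xi \in level k) := in_fset_level k xi.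
have lK (t : K) : level k (val t) by have := valP t; rewrite KP in_setE.
have decomp (g : dconfig -> R) z : level k z ->
    g z = \sum_(t : K) g (val t) * (z == val t)%:R.
  move=> lz; have Kz : z \in K by rewrite KP in_setE.
  rewrite (bigD1 [` Kz]%fset) //= eqxx mulr1 big1 ?addr0 // => t tz.
  by case: eqP => [e|]; rewrite ?mulr0 //; move: tz; rewrite -val_eqE /= e eqxx.
(* Identity rows at the absorbing configurations build the boundary condition into a square matrix;
   its monotonicity is then exactly the maximum principle. *)
pose A (t t' : K) : R := if (0 < bulk (val t))%N
  then - gen_dual G sigma (fun z => (z == val t')%:R) (val t)
  else (val t == val t')%:R.
have AE (g : dconfig -> R) t : \sum_t' A t t' * g (val t') =
    if (0 < bulk (val t))%N then - gen_dual G sigma g (val t) else g (val t).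
  rewrite /A; case: ifP => bt; last first.
    by rewrite (decomp g (val t)) //; apply: eq_bigr => t' _; rewrite mulrC.
  rewrite (eq_gen_dual (lK t) (decomp g)) gen_dualE jump_gen_sum -sumrN.
  by apply: eq_bigr => t' _; rewrite gen_dualE; ring.
have [|c [c0 cA]] := @nonneg_left_solution R K A.
  move=> v Av t.
  pose g (z : dconfig) : R := \sum_(t : K) v t * (z == val t)%:R.
  have gv (t' : K) : g (val t') = v t'.
    rewrite /g (bigD1 t') //= eqxx mulr1 big1 ?addr0 // => u ut.
    by rewrite val_eqE eq_sym (negPf ut) mulr0.
  have {}Av (t' : K) : 0 <= if (0 < bulk (val t'))%N
      then - gen_dual G sigma g (val t') else g (val t').
    by rewrite -AE; under eq_bigr => u _ do rewrite gv.
  rewrite -gv -oppr_le0 -mulN1r.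
  apply: (@max_principle k (fun z => -1 * g z) _ _ _ (lK t)) => z lz bz.
  - have Kz : z \in K by rewrite KP in_setE.
    rewrite gen_dualE jump_genZ mulN1r -gen_dualE.
    by have := Av [` Kz]%fset; rewrite /= bz.
  - have Kz : z \in K by rewrite KP in_setE.
    by have := Av [` Kz]%fset; rewrite /= bz ltnn mulN1r oppr_le0.
exists (fun z => \sum_(t : K) c t * (z == val t)%:R); split=> [z|D].
  by apply: sumr_ge0 => t _; rewrite mulr_ge0.
have cE (t' : K) : \sum_(t : K) c t * (val t' == val t)%:R = c t'.
  rewrite (bigD1 t') //= eqxx mulr1 big1 ?addr0 // => u ut.
  by rewrite val_eqE eq_sym (negPf ut) mulr0.
rewrite !big_seq_fsetE /=.
under eq_bigr do rewrite cE.
under [X in _ = X - _]eq_bigr do rewrite cE.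
have -> : \sum_(t : K) D (val t) = \sum_(t : K) c t * \sum_(t' : K) A t t' * D (val t').
  under [RHS]eq_bigr do rewrite mulr_sumr.
  rewrite exchange_big /=; apply: eq_bigr => t' _.
  by under eq_bigr do rewrite mulrA; rewrite -mulr_suml cA mul1r.
rewrite (bigID (fun t : K => (0 < bulk (val t))%N) xpredT) /= opprD addrA addrAC addrC.
under [X in _ = - X + _]eq_bigr => t bt do rewrite AE bt mulrN.
rewrite sumrN opprK -[LHS]addr0; congr (_ + _); apply/esym/eqP.
rewrite subr_eq0; apply/eqP; apply: eq_big => [t|t]; rewrite ?lt0n ?negbK // => bt.
by rewrite AE ifN // -eqn0Ngt.
Qed.

End Dual.

(** * Markov processes on configurations *)

Section FineProbability.
Context {R : realType} {d : measure_display} {T : measurableType d}.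
Variable P : probability T R.

Lemma fineP_ge0 A : 0 <= fine (P A).
Proof. by rewrite fine_ge0. Qed.

Lemma fineP_le1 A : measurable A -> fine (P A) <= 1.
Proof.
move=> mA; rewrite -lee_fin fineK ?fin_num_measure //; exact: probability_le1.
Qed.

Lemma fineP_le A B : measurable A -> measurable B -> A `<=` B ->
  fine (P A) <= fine (P B).
Proof.
by move=> mA mB AB; rewrite fine_le ?fin_num_measure // le_measure ?inE.
Qed.

Lemma finePE A : measurable A -> P A = (fine (P A))%:E.
Proof. by move=> mA; rewrite fineK // fin_num_measure. Qed.

Lemma fineP_eq0 A : measurable A -> fine (P A) = 0 -> P A = 0.
Proof. by move=> /finePE-> /= ->. Qed.

Lemma fineP_setID A B : measurable A -> measurable B ->
  fine (P A) = fine (P (A `&` B)) + fine (P (A `\` B)).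
Proof.
move=> mA mB; rewrite -fineD ?fin_num_measure //; [|exact: measurableI|exact: measurableD].
by rewrite addeC -measureDI.
Qed.

Lemma fineP_fset (I : finType) (X : T -> config I) (E : set T) (C : {fset config I}) :
  measurable E -> (forall A, measurable (X @^-1` A)) ->
  fine (P (E `&` X @^-1` [set` C])) = \sum_(a <- C) fine (P (E `&` X @^-1` [set a])).
Proof.
move=> mE mX.
have -> : E `&` X @^-1` [set` C] = \bigcup_(a in [set` C]) (E `&` X @^-1` [set a]).
  apply/seteqP; split=> [w [Ew /= Cw]|w [a /= Ca [Ew /= ->]]] //.
  by exists (X w).
rewrite measure_fin_bigcup; first last.
- by move=> a _; apply: measurableI.
- by move=> a b _ _ [w [[_ /= <-] [_ /= <-]]].
- exact: finite_fset.
rewrite fsbig_finite ?finite_fset // set_fsetK.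
rewrite -[RHS]/(fine (_)%:E) -sumEFin; congr fine; apply: eq_bigr => a _.
by rewrite -finePE //; apply: measurableI.
Qed.

End FineProbability.

Section Process.
Context {R : realType} {I : finType} {S : set (config I)}.
Context {L : (config I -> R) -> config I -> R} (M : markov_process S L).
Implicit Types (x a b z : config I) (C : {fset config I}).

Lemma measurable_config (A : set (config I)) : measurable A.
Proof. by []. Qed.

Lemma measurable_state t (A : set (config I)) :
  0 <= t -> measurable (mp_X M t @^-1` A).
Proof. by move=> t0; rewrite -[X in measurable X]setTI; apply: mp_measurable. Qed.

Definition trans x (t : R) a : R := fine (mp_law M x (mp_X M t @^-1` [set a])).

Lemma trans_ge0 x t a : 0 <= trans x t a.
Proof. exact: fineP_ge0. Qed.

Lemma trans_fset x t C : 0 <= t ->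
  \sum_(a <- C) trans x t a = fine (mp_law M x (mp_X M t @^-1` [set` C])).
Proof.
move=> t0; have := @fineP_fset _ _ _ (mp_law M x) _ (mp_X M t) setT C measurableT.
rewrite setTI => ->; last by move=> A; apply: measurable_state.
by apply: eq_bigr => a _; rewrite setTI.
Qed.

Lemma sum_trans_le1 x t C : 0 <= t -> \sum_(a <- C) trans x t a <= 1.
Proof. by move=> t0; rewrite trans_fset // fineP_le1 //; apply: measurable_state. Qed.

Lemma trans_markov x a b s t : S x -> S a -> 0 <= s -> 0 <= t ->
  fine (mp_law M x (mp_X M s @^-1` [set a] `&` mp_X M (s + t) @^-1` [set b]))
  = trans x s a * trans a t b.
Proof.
move=> Sx Sa s0 t0.
have u0 : forall i : 'I_0, 0 <= (fun=> 0 : R) i <= s by case.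
have := @mp_markov _ _ _ _ _ M x a b s t 0 (fun=> 0) (fun=> x) Sx Sa s0 t0 u0.
rewrite (_ : [set w | _] = setT) /=; last by apply/seteqP; split=> // w _ [].
rewrite setTI => ->; rewrite fineM ?fin_num_measure //; exact: measurable_state.
Qed.

(** Only an inequality, since the path may be outside [C] at the intermediate time [s]; [trans_CK]
    is the case where [C] carries all the mass at time [s]. *)
Lemma trans_CK_ge x s t C b : S x -> {in C, forall a, S a} -> 0 <= s -> 0 <= t ->
  \sum_(a <- C) trans x s a * trans a t b <= trans x (s + t) b.
Proof.
move=> Sx SC s0 t0; have st0 : 0 <= s + t by exact: addr_ge0.
have -> : \sum_(a <- C) trans x s a * trans a t b = \sum_(a <- C)
    fine (mp_law M x (mp_X M (s + t) @^-1` [set b] `&` mp_X M s @^-1` [set a])).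
  by rewrite !big_seq; apply: eq_bigr => a aC; rewrite setIC trans_markov //; exact: SC.
rewrite -fineP_fset; last 2 first.
- exact: measurable_state.
- by move=> A; apply: measurable_state.
apply: fineP_le; last exact: subIsetl.
- by apply: measurableI; apply: measurable_state.
- exact: measurable_state.
Qed.

Lemma trans_CK x s t C b : S x -> {in C, forall a, S a} -> 0 <= s -> 0 <= t ->
  \sum_(a <- C) trans x s a = 1 ->
  trans x (s + t) b = \sum_(a <- C) trans x s a * trans a t b.
Proof.
move=> Sx SC s0 t0 C1; have st0 : 0 <= s + t by exact: addr_ge0.
have -> : \sum_(a <- C) trans x s a * trans a t b = \sum_(a <- C)
    fine (mp_law M x (mp_X M (s + t) @^-1` [set b] `&` mp_X M s @^-1` [set a])).
  by rewrite !big_seq; apply: eq_bigr => a aC; rewrite setIC trans_markov //; exact: SC.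
have mCs : measurable (mp_X M s @^-1` [set` C]) by exact: measurable_state.
have mb : measurable (mp_X M (s + t) @^-1` [set b]) by exact: measurable_state.
rewrite -fineP_fset //; last by move=> A; apply: measurable_state.
rewrite [LHS](fineP_setID _ mb mCs) -[RHS]addr0; congr (_ + _).
apply/eqP; rewrite eq_le fineP_ge0 andbT.
apply: (@le_trans _ _ (fine (mp_law M x (setT `\` mp_X M s @^-1` [set` C])))).
  by apply: fineP_le; rewrite ?setTD; [exact: measurableD|exact: measurableC|move=> w []].
have := fineP_setID (mp_law M x) measurableT mCs.
rewrite probability_setT setTI -trans_fset // C1 /= => /eqP.
by rewrite -subr_eq0 opprD addrA subrr add0r oppr_eq0 => /eqP->.
Qed.

Lemma trans_start x : S x -> trans x 0 x = 1.
Proof. by move=> Sx; rewrite /trans mp_start. Qed.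

Lemma expectation_trans x t C (g : config I -> R) : 0 <= t ->
  (forall a, a \notin C -> g a = 0) ->
  ('E_(mp_law M x)[g \o mp_X M t])%E = (\sum_(a <- C) g a * trans x t a)%:E.
Proof.
move=> t0 gC; rewrite unlock.
rewrite (_ : (fun w => _) = fun w =>
    \sum_(a <- C) ((g a)%:E * (\1_(mp_X M t @^-1` [set a]) w)%:E))%E; last first.
  apply: funext => w /=.
  have [Cw|Cw] := boolP (mp_X M t w \in C); last first.
    rewrite gC // big1_seq // => a /andP[_ aC]; rewrite indicE memNset ?mule0 //= => /= wa.
    by rewrite wa aC in Cw.
  rewrite [RHS](bigD1_seq (mp_X M t w)) ?fset_uniq //= indicE mem_set // mule1 big1 ?addr0 // => a aw.
  by rewrite indicE memNset ?mule0 //= => wa; rewrite wa eqxx in aw.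
have mX a : measurable (mp_X M t @^-1` [set a]) by exact: measurable_state.
rewrite integral_sum // => [|a]; last first.
  apply: integrableZl => //; exact: integrable_indic.
rewrite -sumEFin; apply: eq_bigr => a _.
rewrite integralZl //; last exact: integrable_indic.
by rewrite integral_indic // setIT EFinM /trans -finePE.
Qed.

Lemma trans_generator x C (g : config I -> R) : S x ->
  (forall a, a \notin C -> g a = 0) ->
  h^-1 * (\sum_(a <- C) g a * trans x h a - g x) @[h --> 0^'+] --> L g x.
Proof.
move=> Sx gC; have bg : exists M0 : R, forall y, `|g y| <= M0.
  exists (\sum_(a <- C) `|g a|) => y.
  have [Cy|/gC->] := boolP (y \in C); last by rewrite normr0 sumr_ge0.
  by rewrite (bigD1_seq y) ?fset_uniq //= lerDl sumr_ge0.
apply: cvg_trans (mp_generator M Sx bg); apply: near_eq_cvg.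
near=> h; have h0 : 0 < h by near: h; exact: nbhs_right_gt.
by rewrite (expectation_trans x (ltW h0) gC).
Unshelve. all: by end_near. Qed.

(* The probability of leaving [C] by time [t] is subadditive in [t], up to taking
   the maximum over [C], and [o(t)] by the generator condition. *)
Lemma trans_closed C : {in C, forall a, S a} ->
  {in C, forall a, L (fun z => (z \in C)%:R) a = 0} ->
  forall x t, x \in C -> 0 <= t -> \sum_(a <- C) trans x t a = 1.
Proof.
move=> SC LC.
pose v x t : R := 1 - \sum_(a <- C) trans x t a.
have v0 x t : 0 <= t -> 0 <= v x t by move=> t0; rewrite subr_ge0 sum_trans_le1.
pose W t : R := \sum_(a <- C) v a t.
have vW x t : 0 <= t -> x \in C -> v x t <= W t.
  by move=> t0 xC; rewrite /W (bigD1_seq x) ?fset_uniq //= lerDl sumr_ge0 // => a _; exact: v0.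
(* [v x t] is the probability of being outside [C] at time [t]. A path outside at [s + t] was
   outside at [s], or inside at [s] and outside a time [t] later; the second case costs at most
   [W t] from any point of [C]. *)
have vD x s t : x \in C -> 0 <= s -> 0 <= t -> v x (s + t) <= v x s + W t.
  move=> xC s0 t0; rewrite /v -addrA lerD2l lerNl opprD opprK.
  apply: (@le_trans _ _ (\sum_(a <- C) trans x s a * (1 - W t))).
    rewrite -mulr_suml mulrBr mulr1 lerD2l lerN2.
    by rewrite ler_piMl ?sum_trans_le1 // sumr_ge0 // => a _; exact: v0.
  apply: (@le_trans _ _ (\sum_(b <- C) \sum_(a <- C) trans x s a * trans a t b)).
    rewrite exchange_big /= !big_seq; apply: ler_sum => a aC.
    rewrite -mulr_sumr ler_wpM2l ?trans_ge0 // lerBlDr -lerBlDl.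
    exact: vW.
  by apply: ler_sum => b _; apply: trans_CK_ge => //; exact: SC.
have vn x h n : x \in C -> 0 <= h -> v x (h *+ n) <= W h *+ n.
  move=> xC h0; elim: n => [|n IH].
    rewrite !mulr0n /v subr_le0 (bigD1_seq x) ?fset_uniq //= trans_start; last exact: SC.
    by rewrite lerDl sumr_ge0 // => a _; exact: trans_ge0.
  rewrite !mulrSr; apply: le_trans (vD _ _ _ xC _ h0) _; first exact: mulrn_wge0.
  by rewrite lerD2r.
have Wo : h^-1 * W h @[h --> 0^'+] --> (0 : R).
  rewrite (_ : (fun h => _) = fun h => \sum_(a <- C | a \in C) (h^-1 * v a h)); last first.
    by apply: funext => h; rewrite /W mulr_sumr big_seq.
  rewrite [X in _ --> X](_ : _ = \sum_(a <- C | a \in C) - L (fun z => (z \in C)%:R) a); last first.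
    by rewrite big1 // => a aC; rewrite LC // oppr0.
  apply: cvg_big => [|a aC]; first exact: add_continuous.
  have gC b : b \notin C -> (b \in C)%:R = 0 :> R by move=> /negPf->.
  have /cvgN := trans_generator (SC _ aC) gC; rewrite aC; apply: cvg_trans.
  apply: near_eq_cvg; near=> h => /=.
  rewrite /v -mulrN opprB; congr (_ * (1 - _)).
  by rewrite !big_seq; apply: eq_bigr => b ->; rewrite mul1r.
move=> x t xC t0; apply/eqP; rewrite eq_le sum_trans_le1 //= -subr_le0.
rewrite -/(v x t); move: t0; rewrite le_eqVlt => /predU1P[<-|t0].
  by have := vn x 0 0%N xC (lexx 0); rewrite !mulr0n.
apply/ler_addgt0Pl => e e0; rewrite addr0.
have et : 0 < e / t by exact: divr_gt0.
have /cvgrPdist_lt/(_ (e / t) et) := Wo.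
move=> [dl /= dl0 near_dl].
(* The step [t / n] is shorter than [dl], where [W h < (e / t) h]; the [n] steps together then cost
   at most [e]. *)
pose n := (Num.truncn (t / dl)).+1.
have n0 : 0 < n%:R :> R by rewrite ltr0n.
have tn : 0 < t / n%:R by exact: divr_gt0.
have := near_dl (t / n%:R) _ tn; rewrite /= sub0r normrN gtr0_norm // => /(_ _).
rewrite sub0r normrN => Wt.
have := vn x (t / n%:R) n xC (ltW tn).
rewrite -[_ / _ *+ n]mulr_natr divfK ?gt_eqF // => /le_trans; apply.
rewrite -[W _ *+ n]mulr_natr.
have {}Wt : (t / n%:R)^-1 * W (t / n%:R) <= e / t.
  apply/ltW/(le_lt_trans (ler_norm _))/Wt.
  rewrite ltr_pdivrMr // -ltr_pdivrMl // mulrC; exact: truncnS_gt.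
move: Wt; rewrite invf_div -(ler_pM2r t0) divfK ?gt_eqF //; apply: le_trans.
by rewrite mulrAC divfK ?gt_eqF // mulrC.
Unshelve. all: by end_near. Qed.

End Process.

(** * Absorption probabilities *)

Section Absorption.
Context {R : realType} {m : nat} (G : geometry R m) (sigma : int).
Hypothesis sigmaP : sigma \in [:: -1; 0; 1 : int].
Variable M : dual_process G sigma.
Local Notation dconfig := (config (dsite m)).
Local Notation S := (confs G sigma (@dV m)).
Local Notation level := (level G sigma).
Implicit Types (xi zeta z : dconfig).

Lemma trans_level k xi t : level k xi -> 0 <= t ->
  \sum_(a <- fset_set (level k)) trans M xi t a = 1.
Proof.
move=> lxi t0; apply: trans_closed => //; last by rewrite in_fset_level inE.
- by move=> a; rewrite in_fset_level inE => -[].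
- move=> a; rewrite in_fset_level inE => la.
  rewrite (eq_gen_dual (g := fun=> 1) la); first by rewrite gen_dualE jump_gen_cst.
  by move=> z lz; rewrite in_fset_level mem_set.
Qed.

Lemma gen_dual_absorbing z g : bulk z = 0%N -> gen_dual G sigma g z = 0.
Proof.
move=> z0; rewrite gen_dualE /jump_gen big1 // => -[xy|b] _ /=.
- by rewrite /bulk_rate bulk0_site // mul0r mulr0 mul0r.
- by rewrite bulk0_site // mulr0 mul0r.
Qed.

Lemma trans_absorbed z t : S z -> bulk z = 0%N -> 0 <= t -> trans M z t z = 1.
Proof.
move=> Sz z0 t0; have := @trans_closed _ _ _ _ M [fset z]%fset _ _ z t _ t0.
rewrite big_seq_fset1; apply; rewrite ?inE //.
- by move=> a; rewrite inE => /eqP->.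
- by move=> a; rewrite inE => /eqP->; rewrite gen_dual_absorbing.
Qed.

Definition all_left (k : nat) : dconfig := [ffun c => if c == dL then k else 0%N].

Lemma bulk_all_left k : bulk (all_left k) = 0%N.
Proof. by rewrite /bulk big1 // => x _; rewrite ffunE. Qed.

Lemma csize_all_left k : csize (all_left k) = k.
Proof. by rewrite csize_bulk bulk_all_left !ffunE /= addn0. Qed.

Lemma level_all_left k : level k (all_left k).
Proof. by split; [move=> _ x; rewrite ffunE | exact: csize_all_left]. Qed.

Lemma all_left_unique k z : csize z = k -> z dL = k -> z = all_left k.
Proof.
move=> zk zL; have := csize_bulk z; rewrite zk zL => kE.
have /eqP : (bulk z + z dR)%N = 0%N by apply: (@addIn k); rewrite add0n addnAC -kE.
rewrite addn_eq0 => /andP[/eqP b0 /eqP r0].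
apply/ffunP => -[x|[]]; rewrite ffunE //=; exact: bulk0_site.
Qed.

Definition hold (n : nat) z : set (mp_Omega M) :=
  [set w | forall t, n%:R <= t -> mp_X M t w = z].

Let grid (n i j : nat) : R := n%:R + i%:R / j.+1%:R.

Let grid_ge0 n i j : 0 <= grid n i j.
Proof. by rewrite addr_ge0 // divr_ge0. Qed.

(** By right continuity in a discrete space, the value at any time is taken again at a slightly
    later grid point, so countably many times decide the event. *)
Lemma holdE n z :
  hold n z = \bigcap_i \bigcap_j mp_X M (grid n i j) @^-1` [set z].
Proof.
apply/seteqP; split=> w /=.
  by move=> h i _ j _; apply: h; rewrite lerDl divr_ge0.
move=> h t nt; have t0 : 0 <= t by apply: le_trans nt.
have [dl /= dl0 near_dl] := mp_rcont w t0.
(* The mesh [1 / j.+1] is below [dl], and [i] is the first grid index strictly after [t], as the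
   right neighbourhood of [t] excludes [t] itself. *)
pose j := Num.truncn (dl^-1).
have jdl : j.+1%:R^-1 < dl.
  by rewrite invf_plt ?posrE ?ltr0n // truncnS_gt.
pose u := (t - n%:R) * j.+1%:R.
have u0 : 0 <= u by rewrite mulr_ge0 // subr_ge0.
pose i := (Num.truncn u).+1.
have ltu : u < i%:R by exact: truncnS_gt.
have leu : i%:R <= u + 1 by rewrite -natr1 lerD2r truncn_le.
have tq : t < grid n i j.
  by rewrite /grid -ltrBlDl ltr_pdivlMr ?ltr0n.
have qt : grid n i j <= t + j.+1%:R^-1.
  rewrite /grid -lerBrDl ler_pdivrMr ?ltr0n // (le_trans leu) //.
  by rewrite /u addrAC [X in _ <= X]mulrDl mulVf.
rewrite -(near_dl (grid n i j)) //.
- exact: (h i Logic.I j Logic.I).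
- rewrite /= distrC ger0_norm ?subr_ge0 ?ltW //.
  by apply: le_lt_trans jdl; rewrite lerBlDl.
Qed.

Lemma measurable_hold n z : measurable (hold n z).
Proof.
rewrite holdE; apply: bigcapT_measurable => i; apply: bigcapT_measurable => j.
exact: measurable_state.
Qed.

(** For one fixed later time the Markov property loses no mass, as [z] is absorbing; by [holdE]
    countably many such times suffice. *)
Lemma law_hold xi n z : S xi -> S z -> bulk z = 0%N ->
  fine (mp_law M xi (hold n z)) = trans M xi n%:R z.
Proof.
move=> Sxi Sz z0; pose An := mp_X M n%:R @^-1` [set z].
have mAn : measurable An by exact: measurable_state.
have mX i j : measurable (mp_X M (grid n i j) @^-1` [set z]) by exact: measurable_state.
have mh := measurable_hold n z.
rewrite /trans -/An (fineP_setID _ mAn mh).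
have -> : An `&` hold n z = hold n z.
  by apply/setIidPr => w; rewrite /An /=; apply.
rewrite -[LHS]addr0; congr (_ + _); apply/esym.
suff -> : mp_law M xi (An `\` hold n z) = 0 by [].
apply/negligibleP; first exact: measurableD.
apply: (@negligibleS _ _ _ _ (\bigcup_i \bigcup_j (An `\` mp_X M (grid n i j) @^-1` [set z]))).
  move=> w [Anw]; rewrite holdE -[X in X -> _]/((~` _) w) setC_bigcap => -[i _].
  rewrite setC_bigcap => -[j _ hw]; exists i => //; exists j => //.
apply: negligible_bigcup => i; apply: negligible_bigcup => j.
apply/negligibleP; first exact: measurableD.
apply: fineP_eq0; first exact: measurableD.
have := fineP_setID (mp_law M xi) mAn (mX i j).
rewrite /An /grid trans_markov // ?divr_ge0 // trans_absorbed ?divr_ge0 // mulr1.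
rewrite -/(trans M xi n%:R z) => /eqP; rewrite -subr_eq0 opprD addrA subrr add0r oppr_eq0.
by move=> /eqP->.
Qed.

(** The event in [prob_all_L] fixes only the [L] coordinate of the limit. Almost surely the path is
    on its level at all integer times, so the limit must be [all_left k]; up to a null set the event
    is the increasing union of the [hold n (all_left k)]. *)
Lemma cvg_prob_all_L k xi : level k xi ->
  trans M xi n%:R (all_left k) @[n --> \oo] --> prob_all_L M xi.
Proof.
move=> lxi; have [Sxi sxi] := lxi; have [Sz _] := level_all_left k.
set z := all_left k in Sz *; have z0 : bulk z = 0%N := bulk_all_left k.
rewrite /prob_all_L; set E := [set w | _].
have EE : E = \bigcup_n \bigcup_(y in [set: dconfig]) (if y dL == k then hold n y else set0).
  apply/seteqP; split=> w.
    move=> [y [[T0 [_ hT]] yk]].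
    exists (Num.truncn (Num.max T0 0)).+1 => //; exists y => //.
    rewrite yk sxi eqxx => t nt; apply: hT; apply: lt_le_trans nt.
    by rewrite (le_lt_trans _ (truncnS_gt _)) // le_max lexx.
  move=> [n _ [y _]]; case: eqP => // yk hw; exists y; split; last by rewrite yk.
  by exists n%:R; split; rewrite ?num_real // => t /ltW; apply: hw.
have mE : measurable E.
  rewrite EE; apply: bigcupT_measurable => n.
  apply: countable_bigcupT_measurable => // y.
  by case: ifP => // _; exact: measurable_hold.
pose B := \bigcup_n hold n z.
have mB : measurable B by apply: bigcupT_measurable => n; exact: measurable_hold.
have BE : B `<=` E.
  move=> w [n _ hw]; rewrite EE; exists n => //; exists z => //.
  by rewrite (_ : z dL == k) // ffunE eqxx.
have EB0 : mp_law M xi (E `\` B) = 0.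
  apply/negligibleP; first exact: measurableD.
  apply: (@negligibleS _ _ _ _ (\bigcup_n ~` (mp_X M n%:R @^-1` [set` fset_set (level k)]))).
    move=> w [Ew Bw]; move: Ew; rewrite EE => -[n _ [y _]].
    case: eqP => // yk hw; exists n => //=; rewrite hw // in_fset_level inE => -[_ sy].
    by apply: Bw; exists n => //; rewrite -[z](all_left_unique sy yk).
  apply: negligible_bigcup => n.
  have mK : measurable (mp_X M n%:R @^-1` [set` fset_set (level k)]).
    exact: measurable_state.
  apply/negligibleP; first exact: measurableC.
  apply: fineP_eq0; first exact: measurableC.
  have := fineP_setID (mp_law M xi) measurableT mK.
  rewrite setTI setTD probability_setT -trans_fset // trans_level // => /esym/eqP.
  by rewrite -subr_eq0 addrAC subrr add0r => /eqP.
have -> : fine (mp_law M xi E) = fine (mp_law M xi B).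
  by rewrite (fineP_setID _ mE mB) EB0 addr0; congr (fine (_ _)); apply/setIidPr.
rewrite (_ : (fun n => _) = fun n => fine (mp_law M xi (hold n z))); last first.
  by apply: funext => n; rewrite law_hold.
apply: fine_cvg; rewrite -finePE //.
apply: nondecreasing_cvg_mu => //; first by move=> n; exact: measurable_hold.
move=> i j ij; apply/subsetPset => w hw t jt; apply: hw; apply: le_trans jt.
by rewrite ler_nat.
Qed.

Lemma trans_absorbed_nondecreasing xi z s t : S xi -> S z -> bulk z = 0%N ->
  0 <= s -> s <= t -> trans M xi s z <= trans M xi t z.
Proof.
move=> Sxi Sz z0 s0 st; have ts0 : 0 <= t - s by rewrite subr_ge0.
have := @trans_CK_ge _ _ _ _ M xi s (t - s) [fset z]%fset z Sxi _ s0 ts0.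
rewrite big_seq_fset1 trans_absorbed // mulr1 subrKC; apply.
by move=> a; rewrite inE => /eqP->.
Qed.

(** Letting the remaining time tend to infinity in the Markov property at time [t] shows that the
    mean of [h] at time [t] is [h xi]. Being constant in [t] it has derivative 0, which is the
    generator. The generator is tested on a finitely supported [g], equal to [h] on the level and 0
    elsewhere; the dual generator does not see the difference. *)
Lemma prob_all_L_harmonic xi : S xi -> gen_dual G sigma (prob_all_L M) xi = 0.
Proof.
move=> Sxi; pose k := csize xi; have lxi : level k xi by [].
set h := prob_all_L M; pose z := all_left k; pose K := fset_set (level k).
have [Sz _] := level_all_left k; have z0 : bulk z = 0%N := bulk_all_left k.
have KS : {in K, forall a, S a} by move=> a; rewrite in_fset_level inE => -[].
have hinv t : 0 <= t -> \sum_(a <- K) h a * trans M xi t a = h xi.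
  move=> t0.
  have c1 : trans M xi (t + n%:R) z @[n --> \oo] --> \sum_(a <- K) h a * trans M xi t a.
    rewrite (_ : (fun n => _) = fun n : nat =>
        \sum_(a <- K | a \in K) trans M xi t a * trans M a n%:R z); last first.
      by apply: funext => n; rewrite -big_seq; apply: trans_CK => //; exact: trans_level.
    rewrite big_seq; apply: cvg_big => [|a aK]; first exact: add_continuous.
    rewrite mulrC; apply: cvgMr; apply: cvg_prob_all_L.
    by move: aK; rewrite in_fset_level inE.
  have c2 := cvg_prob_all_L lxi.
  have nd : nondecreasing_seq (fun n => trans M xi n%:R z).
    by move=> i j ij; apply: trans_absorbed_nondecreasing; rewrite ?ler_nat.
  have ub n : trans M xi n%:R z <= h xi.
    rewrite -[h xi](cvg_lim _ c2) //; apply: nondecreasing_cvgn_le => //.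
    by apply/cvg_ex; exists (h xi).
  apply: (cvg_unique _ c1) => //.
  (* The known limit is along integers, while [t + n] need not be one: monotonicity in time places
     the value at [t + n] between the value at [n] and the limit. *)
  apply: (squeeze_cvgr _ c2 (cvg_cst (h xi))); near=> n; apply/andP; split.
    by apply: trans_absorbed_nondecreasing; rewrite // lerDr.
  apply: le_trans (ub (Num.truncn (t + n%:R)).+1).
  apply: trans_absorbed_nondecreasing => //; first exact: addr_ge0.
  exact/ltW/truncnS_gt.
pose g a : R := if a \in K then h a else 0.
have gh : gen_dual G sigma g xi = gen_dual G sigma h xi.
  by apply: eq_gen_dual lxi _ => a la; rewrite /g in_fset_level mem_set.
have gK a : a \notin K -> g a = 0 by rewrite /g => /negPf->.
have c := trans_generator M Sxi gK; rewrite -gh.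
apply/esym; apply: (cvg_unique _ _ c) => //.
apply: cvg_near_cst; near=> t.
have t0 : 0 < t by near: t; exact: nbhs_right_gt.
rewrite (_ : \sum_(a <- K) _ = h xi).
  by rewrite /g in_fset_level mem_set // subrr mulr0.
rewrite -(hinv t (ltW t0)) !big_seq; apply: eq_bigr => a aK; by rewrite /g aK.
Unshelve. all: by end_near. Qed.

Lemma prob_all_L_absorbed z : S z -> bulk z = 0%N ->
  prob_all_L M z = (z dR == 0%N)%:R.
Proof.
move=> Sz z0; pose k := csize z; have lz : level k z by [].
have c := cvg_prob_all_L lz; rewrite -(cvg_lim _ c) //.
suff -> : (fun n => trans M z n%:R (all_left k)) = fun=> (z dR == 0%N)%:R.
  by rewrite lim_cst.
apply: funext => n; have [zR|zR] := eqVneq (z dR) 0%N.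
  have <- : z = all_left k.
    by apply: all_left_unique; rewrite // /k csize_bulk z0 zR addn0.
  by rewrite trans_absorbed.
have := sum_trans_le1 M z [fset z; all_left k]%fset (ler0n R n).
rewrite big_fsetU1 ?big_seq_fset1 /=; last first.
  by rewrite inE; apply: contraNneq zR => ->; rewrite ffunE.
rewrite trans_absorbed // -lerBrDl subrr => le0.
by apply/eqP; rewrite eq_le le0 trans_ge0.
Qed.

End Absorption.

(** * Stationary measures *)

Section DiscreteIntegral.
Context {R : realType} {I : finType}.
Variable mu : probability (config I) R.
Implicit Types (C : {fset config I}) (f g : config I -> R) (S : set (config I)).

Definition mass (a : config I) : R := fine (mu [set a]).

Lemma mass_ge0 a : 0 <= mass a.
Proof. exact: fineP_ge0. Qed.

Lemma sum_mass_le1 C : \sum_(a <- C) mass a <= 1.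
Proof.
have := @fineP_fset _ _ _ mu _ id setT C measurableT (fun A => measurable_config A).
rewrite setTI (eq_bigr mass) => [<-|a _]; last by rewrite setTI.
exact: fineP_le1.
Qed.

Lemma ge0_integral_fset C f : (forall a, a \in C -> 0 <= f a) ->
  (\int[mu]_(a in [set` C]) (f a)%:E)%E = (\sum_(a <- C) f a * mass a)%:E.
Proof.
move=> f0; have -> : [set` C] = \big[setU/set0]_(a <- C) [set a].
  rewrite -bigcup_seq; apply/seteqP; split=> a /=; first by exists a.
  by move=> [b /= bC ->].
have tC : trivIset [set` enum_fset C] (fun a : config I => [set a]).
  by move=> a b _ _ [c [/= <- <-]].
rewrite ge0_integral_bigsetU ?fset_uniq //; last first.
  by move=> a; rewrite -bigcup_seq => -[b bC /= ->]; rewrite lee_fin f0.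
rewrite -sumEFin; apply: eq_bigr => a _.
rewrite (eq_integral (cst (f a)%:E)) ?integral_cst // => [|b]; last first.
  by rewrite inE => /= ->.
by rewrite EFinM -finePE.
Qed.

Lemma sum_le_integral S C f : (forall a, S a -> 0 <= f a) ->
  ((\sum_(a <- C | a \in S) f a * mass a)%:E <= \int[mu]_(a in S) (f a)%:E)%E.
Proof.
move=> f0; pose CS := [fset a in C | a \in S]%fset.
have -> : \sum_(a <- C | a \in S) f a * mass a = \sum_(a <- CS) f a * mass a.
  by rewrite -big_filter; apply: perm_big; apply: uniq_perm;
     rewrite ?filter_uniq ?fset_uniq // => a; rewrite mem_filter !inE /= andbC.
rewrite -ge0_integral_fset; last by move=> a; rewrite !inE => /andP[_] /set_mem/f0.
apply: ge0_subset_integral => //.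
by move=> a /=; rewrite !inE => /andP[_] /set_mem.
Qed.

Lemma integral_le_sums S (C : nat -> {fset config I}) f K :
  (forall a, S a -> 0 <= f a) ->
  (forall i j, (i <= j)%N -> {subset C i <= C j}) ->
  (forall a, S a -> exists n, a \in C n) ->
  (forall n, \sum_(a <- C n | a \in S) f a * mass a <= K) ->
  (\int[mu]_(a in S) (f a)%:E <= K%:E)%E.
Proof.
move=> f0 ndC covC leK.
have -> : S = \bigcup_n ([set` C n] `&` S).
  apply/seteqP; split=> [a Sa|a [n _ []] //].
  by have [n aC] := covC _ Sa; exists n.
have c := @ge0_nondecreasing_set_cvg_integral _ _ R
  (fun n => [set` C n] `&` S) (fun a => (f a)%:E) mu.
have {}c : (\int[mu]_(a in [set` C n] `&` S) (f a)%:E)%E @[n --> \oo] -->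
    (\int[mu]_(a in \bigcup_n ([set` C n] `&` S)) (f a)%:E)%E.
  apply: c => // [i j ij|i a [_ Sa]]; last by rewrite lee_fin f0.
  by apply/subsetPset => a [/= aC Sa]; split=> //=; exact: ndC aC.
rewrite -(cvg_lim _ c) //; apply: lime_le; first by apply/cvg_ex; eexists; exact: c.
near=> n.
have -> : [set` C n] `&` S = [set` [fset a in C n | a \in S]%fset].
  apply/seteqP; split=> a /=; rewrite !inE; first by move=> [-> /mem_set->].
  by move=> /andP[-> /set_mem].
rewrite ge0_integral_fset; last by move=> a; rewrite !inE => /andP[_] /set_mem/f0.
rewrite lee_fin; apply: le_trans (leK n); rewrite le_eqVlt; apply/orP; left; apply/eqP.
rewrite -[RHS]big_filter; apply: perm_big; apply: uniq_perm;
     rewrite ?filter_uniq ?fset_uniq // => a; by rewrite mem_filter !inE /= andbC.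
Unshelve. all: by end_near. Qed.

End DiscreteIntegral.

Section Stationary.
Context {R : realType} {I : finType} {S : set (config I)}.
Context {L : (config I -> R) -> config I -> R} (M : markov_process S L).
Context {J : finType} (r : J -> config I -> R) (tau : J -> config I -> config I).
Hypothesis LE : forall f x, L f x = jump_gen r tau f x.
Hypothesis r_ge0 : forall j x, S x -> 0 <= r j x.
Variable mu : probability (config I) R.
Hypothesis mu_st : stationary M mu.

(* Off its support a nonnegative [g] can only gain mass in time [h], so by
   stationarity it must lose mass on the support; let [h] tend to 0. *)
Lemma stationary_finite_support (C : {fset config I}) (g : config I -> R) :
  (forall a, a \notin C -> g a = 0) -> (forall a, 0 <= g a) ->
  \sum_(x <- C | x \in S) mass mu x * L g x <= 0.
Proof.
move=> gC g0; have [_ mu_inv] := mu_st.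
pose F h := \sum_(x <- C | x \in S)
  mass mu x * (h^-1 * (\sum_(a <- C) g a * trans M x h a - g x)).
have F_le0 h : 0 < h -> F h <= 0.
  move=> h0; rewrite /F; under eq_bigr => x _ do rewrite mulrCA.
  rewrite -mulr_sumr pmulr_rle0 ?invr_gt0 //.
  under eq_bigr => x _ do rewrite mulrBr mulr_sumr.
  rewrite sumrB exchange_big /= subr_le0.
  apply: (@le_trans _ _ (\sum_(a <- C) g a * mass mu a)).
    apply: ler_sum => a _.
    rewrite [leLHS](_ : _ = g a * \sum_(x <- C | x \in S) trans M x h a * mass mu x); last first.
      by rewrite mulr_sumr; apply: eq_bigr => x _; rewrite mulrCA [_ * mass _ _]mulrC.
    apply: ler_wpM2l => //; rewrite -lee_fin /mass -[leRHS]finePE //.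
    rewrite -(mu_inv h [set a] (ltW h0) _) //.
    apply: le_trans (sum_le_integral mu C _) _ => [x _|]; first exact: trans_ge0.
    rewrite le_eqVlt; apply/orP; left; apply/eqP; apply: eq_integral => x _.
    by rewrite /trans -finePE //; apply: measurable_state; exact: ltW.
  rewrite [leRHS]big_mkcond /=; apply: ler_sum => a _.
  case: ifPn => [_|aS]; first by rewrite mulrC.
  (* No mass sits outside [S]: apply invariance at time 0 and the fact that paths live in [S]. *)
  suff -> : mass mu a = 0 by rewrite mulr0.
  rewrite /mass -(mu_inv 0 [set a]) // integral0_eq // => x Sx.
  apply: fineP_eq0; first exact: measurable_state.
  rewrite [X in mp_law M x X](_ : _ = set0) ?measure0 //.
  apply/seteqP; split=> // w /= wa; have := @mp_state _ _ _ _ _ M 0 w (lexx 0).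
  by rewrite wa => /mem_set; rewrite (negPf aS).
have cF : F h @[h --> 0^'+] --> \sum_(x <- C | x \in S) mass mu x * L g x.
  apply: cvg_big => [|x /set_mem Sx]; first exact: add_continuous.
  by apply: cvgMr; exact: trans_generator.
rewrite -(cvg_lim _ cF) //; apply: limr_le; first by apply/cvg_ex; eexists; exact: cF.
near=> h; apply: F_le0; near: h; exact: nbhs_right_gt.
Unshelve. all: by end_near. Qed.

(* The case [g = max(n - W, 0)]. *)
Lemma stationary_truncated (W : config I -> R) (n : R) :
  finite_set [set x | W x < n] ->
  0 <= \sum_(x <- fset_set [set x | W x < n] | x \in S) mass mu x * L W x.
Proof.
move=> fW; set C := fset_set _.
have CP x : (x \in C) = (W x < n).
  by rewrite in_fset_set //; apply/idP/idP => [/set_mem//|h]; apply/mem_set.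
pose g x : R := if W x < n then n - W x else 0.
have := @stationary_finite_support C g.
rewrite -oppr_le0 -sumrN => h; apply: le_trans (h _ _) => {h}; last 2 first.
- by move=> a; rewrite CP /g => /negPf->.
- by move=> a; rewrite /g; case: ifP => // /ltW; rewrite subr_ge0.
rewrite big_seq_cond [leRHS]big_seq_cond; apply: ler_sum => x /andP[]; rewrite CP => Wx /set_mem Sx.
rewrite -mulrN ler_wpM2l ?mass_ge0 // !LE.
(* [g] is at least [n - W] everywhere, with equality at [x]; as the rates are nonnegative, its
   generator at [x] is at least that of [n - W]. *)
have -> : - jump_gen r tau W x = jump_gen r tau (fun z => n + -1 * W z) x.
  by rewrite jump_genD jump_gen_cst jump_genZ mulN1r add0r.
apply: le_jump_gen => [j||z]; first exact: r_ge0.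
- by rewrite /g Wx mulN1r.
- by rewrite /g mulN1r; case: ltP => // ?; rewrite subr_le0.
Qed.

End Stationary.

(** * Moments of the stationary measure *)

(** For [n > 2k] each factor [n - i] of the falling factorial is at least half of [n.+1]; smaller
    [n] are covered by the constant. *)
Lemma expn_le_ffact k n : (n.+1 ^ k <= (k.*2.+1) ^ k + 2 ^ k * n ^_ k)%N.
Proof.
have [->|k0] := posnP k; first by [].
have [nk|kn] := leqP n k.*2.
  by apply: leq_trans (leq_addr _ _); rewrite leq_exp2r // ltnS.
apply: leq_trans (leq_addl _ _).
rewrite ffact_prod -{1 2}(card_ord k) -!prod_nat_const -big_split /=.
by apply: leq_prod => i _; have := ltn_ord i; lia.
Qed.

Section PolynomiallyBounded.
Context {R : realType} {I : finType}.
Implicit Types (f g : config I -> R) (eta : config I).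

(** The shift by 1 keeps the base at least 1, so that higher powers dominate lower ones. *)
Definition weight (k : nat) eta : R := (csize eta).+1%:R ^+ k.

Lemma weight_ge1 k eta : 1 <= weight k eta.
Proof. by rewrite /weight exprn_ege1 // ler1n. Qed.

Lemma weight_ge0 k eta : 0 <= weight k eta.
Proof. exact: le_trans ler01 (weight_ge1 k eta). Qed.

Lemma weightD k l eta : weight (k + l) eta = weight k eta * weight l eta.
Proof. exact: exprD. Qed.

Definition polybounded f : Prop :=
  exists C k, 0 <= C /\ forall eta, `|f eta| <= C * weight k eta.

Lemma polybounded_cst c : polybounded (fun=> c).
Proof. by exists `|c|, 0%N; split=> // eta; rewrite /weight expr0 mulr1. Qed.

Lemma polybounded_weight k : polybounded (weight k).
Proof. by exists 1, k; split=> // eta; rewrite mul1r ger0_norm ?weight_ge0. Qed.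

Lemma polyboundedD f g : polybounded f -> polybounded g ->
  polybounded (fun eta => f eta + g eta).
Proof.
move=> [C [k [C0 fC]]] [D [l [D0 gD]]]; exists (C + D), (k + l)%N.
split=> [|eta]; first exact: addr_ge0.
apply: le_trans (ler_normD _ _) _; rewrite weightD mulrDl; apply: lerD.
- apply: le_trans (fC eta) _; rewrite mulrA ler_peMr ?weight_ge1 //.
  by rewrite mulr_ge0 ?weight_ge0.
- apply: le_trans (gD eta) _; rewrite mulrCA ler_peMl ?weight_ge1 //.
  by rewrite mulr_ge0 ?weight_ge0.
Qed.

Lemma polyboundedM f g : polybounded f -> polybounded g ->
  polybounded (fun eta => f eta * g eta).
Proof.
move=> [C [k [C0 fC]]] [D [l [D0 gD]]]; exists (C * D), (k + l)%N.
split=> [|eta]; first exact: mulr_ge0.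
by rewrite normrM weightD mulrACA ler_pM.
Qed.

Lemma polyboundedZ c f : polybounded f -> polybounded (fun eta => c * f eta).
Proof. by move=> Bf; apply: polyboundedM => //; exact: polybounded_cst. Qed.

Lemma polyboundedB f g : polybounded f -> polybounded g ->
  polybounded (fun eta => f eta - g eta).
Proof.
move=> Bf Bg; rewrite (_ : (fun _ => _) = fun eta => f eta + -1 * g eta).
  by apply: polyboundedD => //; exact: polyboundedZ.
by apply: funext => eta; rewrite mulN1r.
Qed.

Lemma polybounded_sum (K : Type) (s : seq K) (P : pred K) (F : K -> config I -> R) :
  (forall j, polybounded (F j)) -> polybounded (fun eta => \sum_(j <- s | P j) F j eta).
Proof.
move=> BF; elim: s => [|j s IH].
  by under eq_fun do rewrite big_nil; exact: polybounded_cst.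
under eq_fun do rewrite big_cons.
by case: (P j) => //; exact: polyboundedD.
Qed.

Lemma polybounded_prod (K : Type) (s : seq K) (P : pred K) (F : K -> config I -> R) :
  (forall j, polybounded (F j)) -> polybounded (fun eta => \prod_(j <- s | P j) F j eta).
Proof.
move=> BF; elim: s => [|j s IH].
  by under eq_fun do rewrite big_nil; exact: polybounded_cst.
under eq_fun do rewrite big_cons.
by case: (P j) => //; exact: polyboundedM.
Qed.

Lemma polybounded_site x : polybounded (fun eta => (eta x)%:R).
Proof.
exists 1, 1%N; split=> // eta; rewrite mul1r /weight expr1 normr_nat ler_nat.
exact: leq_trans (csize_ge x eta) (leqnSn _).
Qed.

Lemma polybounded_comp f (tau : config I -> config I) :
  (forall eta, (csize (tau eta) <= (csize eta).+1)%N) ->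
  polybounded f -> polybounded (f \o tau).
Proof.
(* The factor [2 ^+ k] comes from [csize eta + 2 <= 2 * (csize eta + 1)]. *)
move=> tauP [C [k [C0 fC]]]; exists (C * 2 ^+ k), k.
split=> [|eta]; first by rewrite mulr_ge0 ?exprn_ge0.
apply: le_trans (fC _) _; rewrite -mulrA ler_wpM2l // /weight -exprMn.
rewrite lerXn2r ?nnegrE // -natrM ler_nat.
by have := tauP eta; lia.
Qed.

Lemma polybounded_site_fun s theta a k x :
  polybounded (fun eta => site_fun s theta a k (eta x)).
Proof.
have : forall j, polybounded (fun eta => site_moment s a (eta x) j).
  move=> j; exists `|(rising s a j)^-1|, j; split=> // eta.
  rewrite /site_moment normrM mulrC ler_wpM2l // normr_nat /weight -natrX ler_nat.
  apply: leq_trans (_ : (eta x) ^ j <= _)%N.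
    rewrite ffact_prod -[X in (_ <= _ ^ X)%N](card_ord j) -prod_nat_const.
    by apply: leq_prod => i _; exact: leq_subr.
  have [->|j0] := posnP j; first by rewrite !expn0.
  by rewrite leq_exp2r // ltnW // ltnS csize_ge.
rewrite /site_fun; move: (site_moment s a) => d.
elim: k d => [|k IH] d Bd /=; first exact: Bd.
apply: polyboundedB; first by apply: (IH (fun n j => d n j.+1)) => j; exact: Bd.
by apply: polyboundedZ; exact: IH.
Qed.

End PolynomiallyBounded.

(** * Finiteness of all moments and the stationarity equation *)

Section BoundaryDriven.
Context {R : realType} {m : nat} (G : geometry R m) (sigma : int).
Hypothesis sigmaP : sigma \in [:: -1; 0; 1 : int].
Hypothesis omegaLR_gt0 : 0 < Num.max (omegaL G) (omegaR G).
Variables thetaL thetaR : R.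
Hypotheses (thetaLP : Theta sigma thetaL) (thetaRP : Theta sigma thetaR).
Local Notation V := 'I_m.+1.
Local Notation s := (sigma%:~R : R).
Local Notation S := (confs G sigma (id : V -> V)).
Local Notation dconfig := (config (dsite m)).

Definition theta_of (b : bool) : R := if b then thetaR else thetaL.

Definition bd_rate (j : V * V + bool * bool) (eta : config V) : R :=
  match j with
  | inl xy => bulk_rate G sigma id xy eta
  | inr (b, true) => exit_rate G b * (1 + s * theta_of b) * (eta (exit b))%:R
  | inr (b, false) => exit_rate G b * theta_of b *
      ((alpha G (exit b))%:R + s * (eta (exit b))%:R)
  end.

Definition bd_jump (j : V * V + bool * bool) (eta : config V) : config V :=
  match j with
  | inl xy => jump xy.1 xy.2 eta
  | inr (b, true) => csub eta (delta (exit b))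
  | inr (b, false) => eta + delta (exit b)
  end.

Lemma gen_bdE f eta :
  gen_bd G sigma thetaL thetaR f eta = jump_gen bd_rate bd_jump f eta.
Proof.
rewrite /jump_gen big_sumType /= /gen_bd gen_bulkE -addrA; congr (_ + _).
rewrite (eq_bigr (fun bo => (fun b o => bd_rate (inr (b, o)) eta *
   (f (bd_jump (inr (b, o)) eta) - f eta)) bo.1 bo.2)); last by case.
rewrite -(pair_big xpredT xpredT (fun b o => bd_rate (inr (b, o)) eta *
   (f (bd_jump (inr (b, o)) eta) - f eta))) /= !big_bool /=.
rewrite /gen_reservoir; ring.
Qed.

Lemma theta_ge0 b : 0 <= theta_of b.
Proof. by case: b; [case: thetaRP | case: thetaLP]. Qed.

Lemma theta_hole_ge0 b : 0 <= 1 + s * theta_of b.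
Proof.
case: (intr_sigmaP (R := R) sigmaP) => sE; rewrite sE.
- rewrite mulN1r subr_ge0; have s1 := intr_sigmaN1 sE.
  by case: b; [case: thetaRP => _ | case: thetaLP => _]; apply.
- by rewrite mul0r addr0.
- by rewrite mul1r addr_ge0 ?theta_ge0.
Qed.

Lemma bd_rate_ge0 j eta : S eta -> 0 <= bd_rate j eta.
Proof.
move=> Seta; case: j => [xy|[b []]] /=; first exact: bulk_rate_ge0.
- by rewrite !mulr_ge0 ?exit_rate_ge0 ?theta_hole_ge0.
- rewrite !mulr_ge0 ?exit_rate_ge0 ?theta_ge0 //.
  by apply: rate_ge0; [exact: intr_sigmaP | move=> /intr_sigmaN1/Seta].
Qed.

Lemma csize_csub (I : finType) (eta zeta : config I) : (csize (csub eta zeta) <= csize eta)%N.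
Proof. by apply: leq_sum => x _; rewrite csubE leq_subr. Qed.

Lemma csize_bd_jump j eta : (csize (bd_jump j eta) <= (csize eta).+1)%N.
Proof.
case: j => [[x y]|[b []]] /=.
- by rewrite /jump csizeD csize_delta addn1 ltnS csize_csub.
- exact: leq_trans (csize_csub _ _) (leqnSn _).
- by rewrite csizeD csize_delta addn1.
Qed.

Lemma polybounded_bd_rate j : polybounded (bd_rate j).
Proof.
case: j => [[x y]|[b []]] /=; rewrite /bulk_rate /=.
- apply: polyboundedZ; apply: polyboundedM; first exact: polybounded_site.
  apply: polyboundedD; first exact: polybounded_cst.
  by apply: polyboundedZ; exact: polybounded_site.
- by apply: polyboundedZ; exact: polybounded_site.
- apply: polyboundedZ; apply: polyboundedD; first exact: polybounded_cst.
  by apply: polyboundedZ; exact: polybounded_site.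
Qed.

Lemma polybounded_gen_bd f : polybounded f ->
  polybounded (gen_bd G sigma thetaL thetaR f).
Proof.
move=> Bf.
rewrite (_ : gen_bd G sigma thetaL thetaR f = jump_gen bd_rate bd_jump f); last first.
  by apply: funext => eta; rewrite gen_bdE.
apply: polybounded_sum => j; apply: polyboundedM; first exact: polybounded_bd_rate.
by apply: polyboundedB => //; apply: polybounded_comp Bf => eta; exact: csize_bd_jump.
Qed.

Lemma polybounded_dual_fun theta xi :
  polybounded (dual_fun G sigma thetaL thetaR theta xi).
Proof.
apply: polyboundedM; last exact: polybounded_cst.
by apply: polybounded_prod => x; exact: polybounded_site_fun.
Qed.

Lemma dual_fun_ge0 xi eta : confs G sigma (@dV m) xi ->
  0 <= dual_fun G sigma thetaL thetaR 0 xi eta.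
Proof.
move=> Sxi; rewrite /dual_fun !subr0 mulr_ge0 //; last first.
  by rewrite mulr_ge0 ?exprn_ge0 // ?(theta_ge0 false) ?(theta_ge0 true).
apply: prodr_ge0 => x _; rewrite /site_fun dshift0 /site_moment divr_ge0 //.
apply/ltW/rising_gt0; [exact: intr_sigmaP|exact: alpha_gt0|].
by move=> /intr_sigmaN1/Sxi.
Qed.

Lemma dual_fun_absorbed theta xi eta : bulk xi = 0%N ->
  dual_fun G sigma thetaL thetaR theta xi eta
  = (thetaL - theta) ^+ xi dL * (thetaR - theta) ^+ xi dR.
Proof.
move=> b0; rewrite /dual_fun big1 ?mul1r // => x _.
by rewrite bulk0_site // site_fun0.
Qed.

(** Bulk jumps conserve the particle number. At reservoir [b] the terms in [s * theta] of injection
    and removal cancel, leaving [exit_rate G b] times [theta * alpha - eta x]; hence a bound uniform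
    in [eta]. *)
Lemma gen_bd_csize eta : S eta ->
  gen_bd G sigma thetaL thetaR (fun eta => (csize eta)%:R) eta
  <= \sum_b exit_rate G b * theta_of b * (alpha G (exit b))%:R.
Proof.
move=> Seta; rewrite gen_bdE /jump_gen big_sumType /= big1 ?add0r; last first.
  move=> xy _; have [->|r0] := eqVneq (bulk_rate G sigma id xy eta) 0.
    by rewrite mul0r.
  have [x0 _ _] := bulk_rate_confs (@inj_id _) Seta r0.
  by rewrite csize_jump // subrr mulr0.
rewrite (eq_bigr (fun bo => (fun b o => bd_rate (inr (b, o)) eta *
   ((csize (bd_jump (inr (b, o)) eta))%:R - (csize eta)%:R)) bo.1 bo.2)); last by case.
rewrite -(pair_big xpredT xpredT (fun b o => bd_rate (inr (b, o)) eta *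
   ((csize (bd_jump (inr (b, o)) eta))%:R - (csize eta)%:R))) /=.
apply: ler_sum => b _; rewrite big_bool /= csizeD csize_delta natrD.
set x := exit b; have E : (eta x)%:R * ((csize (csub eta (delta x)))%:R - (csize eta)%:R)
    = - (eta x)%:R :> R.
  have [->|x0] := posnP (eta x); first by rewrite mul0r oppr0.
  have /(congr1 (@csize _)) := csubK (delta_le x0).
  by rewrite csizeD csize_delta => <-; rewrite natrD; ring.
rewrite -mulrA E [_ + 1]addrC addrK mulr1 -subr_ge0.
rewrite [X in 0 <= X](_ : _ = exit_rate G b * (eta x)%:R); last by ring.
by rewrite mulr_ge0 ?exit_rate_ge0.
Qed.

Variable M : bd_process G sigma thetaL thetaR.
Variable mu : probability (config V) R.
Hypothesis mu_st : stationary M mu.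

Definition level_sum (k : nat) (eta : config V) : R :=
  \sum_(xi <- fset_set (level G sigma k)) dual_fun G sigma thetaL thetaR 0 xi eta.

Lemma level_sum_ge0 k eta : 0 <= level_sum k eta.
Proof.
rewrite /level_sum big_seq; apply: sumr_ge0 => xi.
by rewrite in_fset_level => /set_mem[Sxi _]; exact: dual_fun_ge0.
Qed.

Lemma stationary_level_set (W : config V -> R) (n : nat) :
  finite_set [set eta | W eta < n%:R] ->
  0 <= \sum_(eta <- fset_set [set eta | W eta < n%:R] | eta \in S)
         mass mu eta * gen_bd G sigma thetaL thetaR W eta.
Proof.
move=> fW; apply: (stationary_truncated gen_bdE) fW; last exact: mu_st.
exact: bd_rate_ge0.
Qed.

(** The fullest site [x] holds at least a fraction [1 / m.+1] of the particles, and the dual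
    configuration with all [k] particles at [x] contributes to [level_sum] a falling factorial of
    [eta x], which controls its [k]-th power. *)
Lemma weight_le k : exists C, 0 <= C /\
  forall eta, S eta -> weight k eta <= C * (1 + level_sum k eta).
Proof.
pose c0 : R := (m.+2)%:R ^+ k.
pose a : R := ((k.*2.+1) ^ k)%:R.
(* The normalisation is that of the fullest site, which varies with [eta]; summing over all sites
   makes [b] uniform. *)
pose b : R := (2 ^ k)%:R * \sum_x `|rising s (alpha G x) k|.
have b0 : 0 <= b by rewrite mulr_ge0 ?sumr_ge0.
have a0 : 0 <= a by exact: ler0n.
have c00 : 0 <= c0 by exact: exprn_ge0.
exists (c0 * (a + b)); split=> [|eta Seta]; first by rewrite mulr_ge0 ?addr_ge0.
pose x : V := [arg max_(x > ord0) eta x].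
have xmax y : (eta y <= eta x)%N by rewrite /x; case: arg_maxnP => // i _; apply.
have cs : ((csize eta).+1 <= m.+2 * (eta x).+1)%N.
  rewrite mulSn addSn ltnS; apply: leq_trans (leq_addl _ _).
  rewrite -[X in (_ <= X * _)%N](card_ord m.+1) -sum_nat_const.
  by apply: leq_sum => y _; apply: leqW.
have W1 : weight k eta <= c0 * ((eta x).+1 ^ k)%:R.
  by rewrite /weight /c0 natrX -exprMn -natrM lerXn2r ?nnegrE // ler_nat.
apply: le_trans W1 _; rewrite -mulrA ler_wpM2l //.
have := expn_le_ffact k (eta x); rewrite -(ler_nat R) => /le_trans; apply.
rewrite natrD natrM -/a mulrDl; apply: lerD.
  by rewrite ler_peMr // lerDl level_sum_ge0.
rewrite -[b * _]mulrA ler_wpM2l //.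
pose xi : dconfig := [ffun c => if c == dV x then k else 0%N].
have sxi : csize xi = k.
  by rewrite /csize (bigD1 (dV x)) //= ffunE eqxx big1 ?addn0 // => y /negPf yx; rewrite ffunE yx.
(* Under exclusion [k] particles may not fit on [x]; but then [eta x < k] and the falling factorial
   is 0. *)
have [/andP[/eqP s1 ak]|sk] := boolP ((sigma == -1) && (alpha G x < k)%N).
  rewrite ffact_small ?mulr_ge0 ?sumr_ge0 ?addr_ge0 ?level_sum_ge0 //.
  exact: leq_ltn_trans (Seta s1 x) ak.
have Sxi : confs G sigma (@dV m) xi.
  move=> s1 y; rewrite ffunE (inj_eq (@inl_inj _ _)); case: eqP => // ->.
  by rewrite leqNgt; apply: contra sk => ak; rewrite s1 eqxx.
have kx : s = -1 -> (k <= alpha G x)%N.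
  by move=> /intr_sigmaN1/Sxi/(_ x); rewrite ffunE eqxx.
have r0 := rising_gt0 (intr_sigmaP sigmaP) (alpha_gt0 G x) kx.
have DE : dual_fun G sigma thetaL thetaR 0 xi eta = ((eta x) ^_ k)%:R / rising s (alpha G x) k.
  rewrite /dual_fun !ffunE !expr0 !mulr1 (bigD1 x) //= ffunE eqxx big1 ?mulr1.
    by rewrite /site_fun dshift0.
  by move=> y yx; rewrite ffunE (inj_eq (@inl_inj _ _)) (negPf yx) site_fun0.
have Dle : dual_fun G sigma thetaL thetaR 0 xi eta <= level_sum k eta.
  have lxi : xi \in fset_set (level G sigma k) by rewrite in_fset_level; apply/mem_set.
  rewrite /level_sum (bigD1_seq xi) ?fset_uniq //= lerDl big_seq_cond sumr_ge0 // => z /andP[].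
  by rewrite in_fset_level => /set_mem[Sz _] _; exact: dual_fun_ge0.
have -> : ((eta x) ^_ k)%:R = rising s (alpha G x) k * dual_fun G sigma thetaL thetaR 0 xi eta.
  by rewrite DE mulrC divfK ?gt_eqF.
apply: ler_pM => //; first exact: ltW.
- exact: dual_fun_ge0.
- by rewrite (bigD1 x) //= gtr0_norm // lerDl sumr_ge0.
- by apply: le_trans Dle _; rewrite lerDr.
Qed.

(* [level_sum k] is, up to a constant, minus the drift of the Green combination
   of the duality functions; adding the number of particles makes it coercive. *)
Lemma level_sum_truncated k : exists K, exists C : nat -> {fset config V},
  [/\ forall i j, (i <= j)%N -> {subset C i <= C j},
      forall eta, exists n, eta \in C n
    & forall n, \sum_(eta <- C n | eta \in S) mass mu eta * level_sum k eta <= K].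
Proof.
have [c [c0 cE]] := green_weights sigmaP omegaLR_gt0 k.
pose D := dual_fun G sigma thetaL thetaR 0.
pose Lk := fset_set (level G sigma k).
pose W eta : R := \sum_(xi <- Lk | (0 < bulk xi)%N) c xi * D xi eta + (csize eta)%:R.
have W_ge eta : (csize eta)%:R <= W eta.
  rewrite lerDr big_seq_cond sumr_ge0 // => xi /andP[].
  rewrite in_fset_level => /set_mem[Sxi _] _.
  by rewrite mulr_ge0 // dual_fun_ge0.
have fW n : finite_set [set eta | W eta < n%:R].
  apply: sub_finite_set (finite_csize_le V n) => eta /= We.
  by rewrite -(ler_nat R) ltW // (le_lt_trans (W_ge eta)).
(* For an absorbed [xi] the function [D xi] does not depend on [eta], so its value at the empty
   configuration stands for all. *)
pose K1 := \sum_(xi <- Lk | bulk xi == 0%N) c xi * D xi 0.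
pose K2 := \sum_b exit_rate G b * theta_of b * (alpha G (exit b))%:R.
have LW eta : S eta ->
    gen_bd G sigma thetaL thetaR W eta <= (K1 + K2) - level_sum k eta.
  move=> Seta; rewrite gen_bdE jump_genD -(gen_bdE (fun eta => (csize eta)%:R)).
  rewrite jump_gen_sum [leRHS]addrAC; apply: lerD; last exact: gen_bd_csize.
  have -> : K1 - level_sum k eta = \sum_(xi <- Lk | bulk xi == 0%N) c xi * D xi eta
      - \sum_(xi <- Lk) D xi eta.
    congr (_ - _); apply: eq_bigr => xi /eqP b0.
    by rewrite /D !dual_fun_absorbed.
  rewrite -(cE (D ^~ eta)) le_eqVlt; apply/orP; left; apply/eqP.
  rewrite big_seq_cond [RHS]big_seq_cond; apply: eq_bigr => xi /andP[].
  rewrite in_fset_level => /set_mem[Sxi _] _.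
  by rewrite -gen_bdE -duality.
exists `|K1 + K2|, (fun n => fset_set [set eta | W eta < n%:R]).
have inC n eta : (eta \in fset_set [set eta | W eta < n%:R]) = (W eta < n%:R).
  by rewrite in_fset_set //; apply/idP/idP => [/set_mem//|h]; apply/mem_set.
split=> [i j ij eta|eta|n].
- by rewrite !inC => /lt_le_trans; apply; rewrite ler_nat.
- exists (Num.truncn (W eta)).+1; rewrite inC; exact: truncnS_gt.
have h := stationary_level_set (fW n).
set C := fset_set _ in h *.
have {}h : 0 <= \sum_(eta <- C | eta \in S) mass mu eta * ((K1 + K2) - level_sum k eta).
  apply: le_trans h _; apply: ler_sum => eta /set_mem Seta.
  by rewrite ler_wpM2l ?mass_ge0 // LW.
move: h; under eq_bigr do rewrite mulrBr; rewrite sumrB subr_ge0 => /le_trans; apply.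
apply: (@le_trans _ _ (\sum_(eta <- C | eta \in S) mass mu eta * `|K1 + K2|)).
  by apply: ler_sum => eta _; rewrite ler_wpM2l ?mass_ge0 ?ler_norm.
rewrite -mulr_suml ler_piMl //; apply: le_trans (sum_mass_le1 mu C).
by rewrite [leLHS]big_mkcond; apply: ler_sum => eta _; case: ifP => // _;
      exact: mass_ge0.
Qed.

Lemma integrable_polybounded f : polybounded f -> mu.-integrable S (EFin \o f).
Proof.
move=> [C [k [C0 fC]]].
have [C1 [C10 wC]] := weight_le k; have [K [A [ndA covA leK]]] := level_sum_truncated k.
have wfin : (\int[mu]_(eta in S) (C * weight k eta)%:E <= (C * (C1 * (1 + K)))%:E)%E.
  apply: integral_le_sums ndA _ _ => [eta _|eta _|n]; last 2 first.
  - exact: covA.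
  - apply: (@le_trans _ _ (\sum_(eta <- A n | eta \in S)
       C * (C1 * (mass mu eta + mass mu eta * level_sum k eta)))).
      apply: ler_sum => eta /set_mem Seta; rewrite -mulrA ler_wpM2l //.
      rewrite [leRHS](_ : _ = C1 * (1 + level_sum k eta) * mass mu eta); last by ring.
      by rewrite ler_wpM2r ?mass_ge0 ?wC.
    rewrite -!mulr_sumr ler_wpM2l // ler_wpM2l // big_split lerD //.
    apply: le_trans (sum_mass_le1 mu (A n)).
    by rewrite [leLHS]big_mkcond; apply: ler_sum => eta _; case: ifP => // _;
      exact: mass_ge0.
  - by rewrite mulr_ge0 ?weight_ge0.
apply: (@le_integrable _ _ _ _ _ _ _ (fun eta => (C * weight k eta)%:E)) => //.
  move=> eta _ /=; rewrite lee_fin; apply: le_trans (fC eta) _; exact: ler_norm.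
apply/integrableP; split=> //; apply: le_lt_trans (ltry (C * (C1 * (1 + K)))).
apply: le_trans wfin; rewrite le_eqVlt; apply/orP; left; apply/eqP.
by apply: eq_integral => eta _ /=; rewrite ger0_norm ?mulr_ge0 ?weight_ge0.
Qed.

(** The integral is restricted to [S] because duality and [weight_le] hold only there; [meanE]
    returns to the expectation. *)
Definition mean (f : config V -> R) : R := fine (\int[mu]_(eta in S) (f eta)%:E)%E.

Lemma meanD f g : polybounded f -> polybounded g ->
  mean (fun eta => f eta + g eta) = mean f + mean g.
Proof. by move=> Bf Bg; apply: RintegralD => //; exact: integrable_polybounded. Qed.

Lemma meanZ c f : polybounded f -> mean (fun eta => c * f eta) = c * mean f.
Proof. by move=> Bf; apply: RintegralZl => //; exact: integrable_polybounded. Qed.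

Lemma mean_sum (K : Type) (r : seq K) (P : pred K) (c : K -> R) (F : K -> config V -> R) :
  (forall j, polybounded (F j)) ->
  mean (fun eta => \sum_(j <- r | P j) c j * F j eta) = \sum_(j <- r | P j) c j * mean (F j).
Proof.
move=> BF; elim: r => [|j r IH].
  rewrite big_nil /mean; under eq_integral do rewrite big_nil.
  by rewrite integral0.
rewrite big_cons; under [X in mean X]eq_fun do rewrite big_cons.
case: (P j) => //; rewrite meanD ?meanZ ?IH //; first exact: polyboundedZ.
by apply: polybounded_sum => i; exact: polyboundedZ.
Qed.

Lemma eq_mean f g : (forall eta, S eta -> f eta = g eta) -> mean f = mean g.
Proof.
by move=> fg; congr fine; apply: eq_integral => eta /set_mem Seta; rewrite fg.
Qed.

Lemma mean_cst c : mean (fun=> c) = c.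
Proof.
have [muS _] := mu_st.
by rewrite /mean integral_cst // [X in (_ * X)%E](_ : _ = 1%E) ?mule1.
Qed.

Lemma meanE f : polybounded f -> ('E_mu[f])%E = (mean f)%:E.
Proof.
move=> Bf; have If := integrable_polybounded Bf; have [muS _] := mu_st.
have muNS : mu (~` S) = 0%E by rewrite probability_setC // muS subee.
rewrite /mean fineK ?integrable_fin_num // unlock.
rewrite (@negligible_integral _ _ _ _ _ (~` S)) ?setTD ?setCK //.
by apply/(@negligible_integrable _ _ _ _ _ (~` S)); rewrite ?setTD ?setCK.
Qed.

(* The truncation argument applies to the coercive functions
   [weight k.+1 + u f] for all real [u], whence equality. *)
Lemma mean_gen_bd f : polybounded f -> mean (gen_bd G sigma thetaL thetaR f) = 0.
Proof.
move=> Bf; have [C [k [C0 fC]]] := Bf.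
pose gen := gen_bd G sigma thetaL thetaR.
have Bw := @polybounded_weight R V k.+1.
suff pos u : 0 <= mean (gen (weight k.+1)) + u * mean (gen f).
  apply/eqP/negPn/negP => nz.
  (* This [u] would make the nonnegative quantity equal to -1. *)
  have := pos (- (mean (gen (weight k.+1)) + 1) / mean (gen f)).
  by rewrite divfK // opprD addrA subrr add0r oppr_ge0 ler10.
pose W eta := weight k.+1 eta + u * f eta.
have BW : polybounded W by apply: polyboundedD => //; exact: polyboundedZ.
have genW : gen W = fun eta => gen (weight k.+1) eta + u * gen f eta.
  by apply: funext => eta; rewrite /gen !gen_bdE jump_genD jump_genZ.
rewrite -meanZ; last exact: polybounded_gen_bd.
rewrite -meanD -?genW; last 2 first.
- exact: polybounded_gen_bd.
- by apply: polyboundedZ; exact: polybounded_gen_bd.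
(* [weight k.+1] has one factor [(csize eta).+1] more than the bound on [f]; once it exceeds
   [|u| * C] it absorbs [u * f], which makes [W] coercive. *)
have W_ge (n : nat) eta : `|u| * C + n%:R <= (csize eta).+1%:R -> n%:R <= W eta.
  move=> hn; have W1 : weight k eta * ((csize eta).+1%:R - `|u| * C) <= W eta.
    rewrite /W [X in _ <= X + _](_ : _ = weight k eta * (csize eta).+1%:R); last first.
      by rewrite /weight exprSr.
    rewrite mulrBr lerD2l lerNl; apply: le_trans (ler_norm _) _.
    by rewrite normrN normrM mulrCA ler_wpM2l // mulrC.
  apply: le_trans W1; apply: (@le_trans _ _ ((csize eta).+1%:R - `|u| * C)).
    by rewrite lerBrDl.
  rewrite ler_peMl ?weight_ge1 // subr_ge0 (le_trans _ hn) // lerDl //.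
have fW (n : nat) : finite_set [set eta | W eta < n%:R].
  pose N := (Num.truncn (`|u| * C + n%:R)).+1.
  apply: sub_finite_set (finite_csize_le V N) => eta /=.
  rewrite ltNge => We; rewrite leqNgt; apply: contra We => Neta.
  apply: W_ge; apply: ltW; apply: lt_le_trans (truncnS_gt _) _.
  by rewrite ler_nat; apply: leq_trans (ltnW Neta) (leqnSn _).
have [D [l [D0 gD]]] := polybounded_gen_bd BW.
have Bh : polybounded (fun eta : config V => D * weight l eta).
  by apply: polyboundedZ; exact: polybounded_weight.
have BgW := polybounded_gen_bd BW.
(* Adding the bound [D * weight l] makes the integrand nonnegative. Its integral then dominates its
   truncated sums, these dominate the truncated sums of [D * weight l] by [stationary_level_set],
   and the latter exhaust the mean of [D * weight l]. *)
rewrite -(lerD2l (mean (fun eta : config V => D * weight l eta))) addr0 -meanD //.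
have Bs := polyboundedD Bh BgW.
rewrite -lee_fin {1}/mean fineK; last first.
  by apply: integrable_fin_num => //; exact: integrable_polybounded.
have inC (n : nat) eta : (eta \in fset_set [set eta | W eta < n%:R]) = (W eta < n%:R).
  by rewrite in_fset_set //; apply/idP/idP => [/set_mem//|h]; apply/mem_set.
apply: (@integral_le_sums _ _ _ _ (fun n : nat => fset_set [set eta | W eta < n%:R])).
- by move=> eta _; rewrite mulr_ge0 ?weight_ge0.
- by move=> i j ij eta; rewrite !inC => /lt_le_trans; apply; rewrite ler_nat.
- by move=> eta _; exists (Num.truncn (W eta)).+1; rewrite inC; exact: truncnS_gt.
move=> n; rewrite -lee_fin [leRHS]fineK; last first.
  by apply: integrable_fin_num => //; exact: integrable_polybounded.
have s0 eta : S eta -> 0 <= D * weight l eta + gen W eta.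
  by move=> _; rewrite -lerBlDl sub0r lerNl; apply: le_trans (gD eta); rewrite -normrN ler_norm.
apply: le_trans (sum_le_integral mu (fset_set [set eta | W eta < n%:R]) s0).
rewrite lee_fin; under [leRHS]eq_bigr do rewrite mulrDl; rewrite big_split lerDl.
under eq_bigr do rewrite mulrC; exact: stationary_level_set.
Qed.

End BoundaryDriven.

(** * Independent walkers and the expansion of the centred moments *)

Section Absorbed.
Context {R : realType} {m : nat} (G : geometry R m) (sigma : int).
Hypothesis sigmaP : sigma \in [:: -1; 0; 1 : int].
Hypothesis omegaLR_gt0 : 0 < Num.max (omegaL G) (omegaR G).
Variable M : dual_process G sigma.

(** Uniqueness in law of the dual process is not addressed, only that of this probability, as a
    harmonic function with prescribed boundary values. It lets [psi] be fixed before the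
    processes. *)
Lemma prob_all_L_unique (M' : dual_process G sigma) xi :
  confs G sigma (@dV m) xi -> prob_all_L M xi = prob_all_L M' xi.
Proof.
move=> Sxi; apply: (harmonic_unique sigmaP omegaLR_gt0 (k := csize xi)) => //.
- by move=> z [Sz _] _; rewrite !prob_all_L_harmonic.
- by move=> z [Sz _] bz; rewrite !prob_all_L_absorbed.
Qed.

Section Moments.
Variables thetaL thetaR : R.
Hypotheses (thetaLP : Theta sigma thetaL) (thetaRP : Theta sigma thetaR).
Variable bd : bd_process G sigma thetaL thetaR.
Variable mu : probability (config 'I_m.+1) R.
Hypothesis mu_st : stationary bd mu.

Local Notation mean := (mean G sigma mu).
Local Notation D := (dual_fun G sigma thetaL thetaR thetaR).

Lemma gen_dual_mean xi : confs G sigma (@dV m) xi ->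
  gen_dual G sigma (fun z => mean (D z)) xi = 0.
Proof.
move=> Sxi; rewrite gen_dualE /jump_gen.
have pD z : polybounded (D z) by exact: polybounded_dual_fun.
transitivity (\sum_j dual_rate G sigma j xi
    * mean (fun eta => D (dual_jump j xi) eta + -1 * D xi eta)).
  apply: eq_bigr => j _; rewrite (meanD sigmaP _ _ _ mu_st) //; last exact: polyboundedZ.
  by rewrite (meanZ sigmaP _ _ _ mu_st) // mulN1r.
rewrite -(mean_sum sigmaP _ _ _ mu_st) //; last first.
  by move=> j; apply: polyboundedD => //; exact: polyboundedZ.
rewrite -[RHS](mean_gen_bd sigmaP omegaLR_gt0 thetaLP thetaRP mu_st (pD xi)).
apply: eq_mean => eta Seta; rewrite (duality sigmaP) // gen_dualE.
by apply: eq_bigr => j _; rewrite mulN1r.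
Qed.

Lemma mean_dual_fun xi : confs G sigma (@dV m) xi ->
  mean (D xi) = (thetaL - thetaR) ^+ csize xi * prob_all_L M xi.
Proof.
move=> Sxi; have lxi : level G sigma (csize xi) xi by [].
move: (csize xi) lxi => k lxi.
apply: (harmonic_unique sigmaP omegaLR_gt0 (k := k) (f := fun z => mean (D z))
   (g := fun z => (thetaL - thetaR) ^+ k * prob_all_L M z)) => // z [Sz zk] bz.
  rewrite gen_dual_mean // gen_dualE jump_genZ -gen_dualE.
  by rewrite prob_all_L_harmonic // mulr0.
rewrite (@eq_mean _ _ _ _ _ _ (fun=> (thetaL - thetaR) ^+ z dL * (thetaR - thetaR) ^+ z dR)).
  rewrite (mean_cst mu_st) prob_all_L_absorbed // -zk csize_bulk bz add0n subrr expr0n exprD.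
  by case: eqP => [->|_]; rewrite ?expr0 ?mulr1 // !mulr0.
by move=> eta _; exact: dual_fun_absorbed.
Qed.

End Moments.
End Absorbed.

Section Independent.
Context {R : realType} {m : nat} (G : geometry R m).
Hypothesis omegaLR_gt0 : 0 < Num.max (omegaL G) (omegaR G).
Local Notation V := 'I_m.+1.
Local Notation dconfig := (config (dsite m)).

Definition jump_src_site (j : V * V + bool) : V :=
  match j with inl xy => xy.1 | inr b => exit b end.

Definition jump_dst_site (j : V * V + bool) : dsite m :=
  match j with inl xy => dV xy.2 | inr b => inr b end.

Definition walk_rate (j : V * V + bool) : R :=
  match j with
  | inl xy => omega G xy.1 xy.2 * (alpha G xy.2)%:R
  | inr b => exit_rate G b
  end.

Lemma dual_jumpE j (xi : dconfig) :
  dual_jump j xi = jump (dV (jump_src_site j)) (jump_dst_site j) xi.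
Proof. by case: j. Qed.

Lemma dual_rate0 j (xi : dconfig) :
  dual_rate G 0 j xi = walk_rate j * (xi (dV (jump_src_site j)))%:R.
Proof. by case: j => [[x y]|b] //=; rewrite /bulk_rate /= mul0r addr0; ring. Qed.

(** A lone particle never feels the interaction: [sigma] enters through the occupation of the
    target, which is empty unless it is the source, where [omega] is 0. *)
Lemma dual_rate_delta sigma j (y : V) :
  dual_rate G sigma j (delta (dV y)) = walk_rate j * (jump_src_site j == y)%:R.
Proof.
case: j => [[x z]|b] /=; last by rewrite deltaE.
rewrite /bulk_rate /= !deltaE !(inj_eq (@inl_inj _ _)).
have [->|xy] := eqVneq x y; last by rewrite mul0r !mulr0.
have [->|zy] := eqVneq z y; first by rewrite omega_diag !mul0r.
by rewrite mulr0 addr0 mul1r mulr1.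
Qed.

Lemma gen_dual_delta sigma f (y : V) :
  gen_dual G sigma f (delta (dV y)) = \sum_(j | jump_src_site j == y)
    walk_rate j * (f (delta (jump_dst_site j)) - f (delta (dV y))).
Proof.
rewrite gen_dualE /jump_gen [RHS]big_mkcond; apply: eq_bigr => j _.
rewrite dual_rate_delta dual_jumpE; case: eqP => [->|_]; last by rewrite mulr0 mul0r.
rewrite mulr1; congr (_ * (f _ - _)).
by apply/ffunP => c; rewrite jumpE !deltaE subnn.
Qed.

Lemma level_delta sigma (y : dsite m) : level G sigma 1 (delta y).
Proof.
split; last exact: csize_delta.
by move=> _ x; rewrite deltaE (leq_trans (leq_b1 _)) // alpha_gt0.
Qed.

Lemma level1_delta sigma (xi : dconfig) : level G sigma 1 xi -> (0 < bulk xi)%N ->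
  exists y : V, xi = delta (dV y).
Proof.
move=> [_ xi1]; rewrite lt0n sum_nat_eq0 => /forallPn[y /=]; rewrite -lt0n => y0.
exists y; have := csubK (delta_le y0) => /[dup] e <-.
have : csize (csub xi (delta (dV y))) = 0%N.
  by have := congr1 (@csize _) e; rewrite csizeD csize_delta xi1 addn1 => -[].
move=> /eqP; rewrite sum_nat_eq0 => /forallP c0.
by apply/ffunP => c; rewrite addcE (eqP (c0 c)).
Qed.

Lemma prob_all_L_delta sigma (M : dual_process G sigma) (irw : dual_process G 0) (y : V) :
  sigma \in [:: -1; 0; 1 : int] ->
  prob_all_L M (delta (dV y)) = prob_all_L irw (delta (dV y)).
Proof.
move=> sigmaP; apply: (harmonic_unique sigmaP omegaLR_gt0 (k := 1)); last exact: level_delta.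
- move=> z lz bz; rewrite prob_all_L_harmonic //; last by case: lz.
  have [x ->] := level1_delta lz bz.
  by rewrite gen_dual_delta -(gen_dual_delta 0) prob_all_L_harmonic.
- by move=> z [Sz _] bz; rewrite !prob_all_L_absorbed.
Qed.

(* Independence: the product over the particles of the one-particle absorption
   probabilities is harmonic for the independent walkers. *)
Lemma prob_all_L_irw (irw : dual_process G 0) (xi : dconfig) :
  prob_all_L irw xi = (\prod_(x : V) prob_all_L irw (delta (dV x)) ^+ xi (dV x))
                      * (xi dR == 0%N)%:R.
Proof.
have s0 : (0 : int) \in [:: -1; 0; 1 : int] by [].
pose p (a : dsite m) := prob_all_L irw (delta a).
have pLR b : p (inr b) = (~~ b)%:R.
  rewrite /p prob_all_L_absorbed ?deltaE //; first by case: b.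
  by rewrite /bulk big1 // => x _; rewrite deltaE.
pose g (z : dconfig) := \prod_(a : dsite m) p a ^+ z a.
have gE z : g z = (\prod_(x : V) p (dV x) ^+ z (dV x)) * (z dR == 0%N)%:R.
  by rewrite /g big_sumType /= big_bool /= !pLR /= expr1n mulr1 expr0n.
rewrite -gE.
have gD y z : g (z + delta y) = g z * p y.
  rewrite /g (eq_bigr (fun a => p a ^+ z a * p a ^+ (delta y a))); last first.
    by move=> a _; rewrite addcE exprD.
  rewrite big_split; congr (_ * _); rewrite (bigD1 y) //= deltaE eqxx expr1 big1 ?mulr1 // => a.
  by rewrite deltaE => /negPf->.
apply: (harmonic_unique s0 omegaLR_gt0 (k := csize xi)) => // z [Sz zk] bz; last first.
  rewrite prob_all_L_absorbed // gE big1 ?mul1r // => x _; by rewrite bulk0_site.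
rewrite prob_all_L_harmonic // gen_dualE /jump_gen.
(* Jumps are grouped by the site [y] they leave. In a product function each of the particles at [y]
   moves by the one-particle generator, the others being a constant factor, so one-particle
   harmonicity kills the group. *)
rewrite (partition_big jump_src_site xpredT) //= big1 // => y _.
transitivity ((z (dV y))%:R * g (csub z (delta (dV y))) *
    gen_dual G 0 (prob_all_L irw) (delta (dV y))); last first.
  by rewrite prob_all_L_harmonic ?mulr0.
rewrite gen_dual_delta mulr_sumr; apply: eq_bigr => j /eqP <-.
rewrite dual_rate0 dual_jumpE -/(p _) -/(p _).
have [->|z0] := posnP (z (dV (jump_src_site j))); first by rewrite !(mulr0, mul0r).
rewrite /jump gD -[in g z](csubK (delta_le z0)) gD; ring.
Qed.

End Independent.

(** * Configurations below a sum of distinct sites as subsets of indices *)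

Section SubsetConfigurations.
Context {R : realType} {m : nat} (G : geometry R m) (sigma : int).
Local Notation V := 'I_m.+1.
Variables (n : nat) (x : 'I_n -> V).
Hypothesis x_inj : injective x.

Definition subset_config (J : {set 'I_n}) : config (dsite m) :=
  \sum_(i in J) delta (dV (x i)).

Lemma subset_configE J y : subset_config J (dV y) = (y \in x @: J).
Proof.
rewrite /subset_config sum_ffunE.
have [/imsetP[i iJ ->]|yJ] := boolP (y \in x @: J).
  rewrite (bigD1 i) //= deltaE eqxx big1 // => j /andP[_ ji].
  by rewrite deltaE !(inj_eq (@inl_inj _ _)) (inj_eq x_inj) eq_sym (negPf ji).
rewrite big1 // => i iJ; rewrite deltaE (inj_eq (@inl_inj _ _)); case: eqP => // yi.
by rewrite yi imset_f in yJ.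
Qed.

Lemma subset_config_site J i : subset_config J (dV (x i)) = (i \in J).
Proof. by rewrite subset_configE mem_imset. Qed.

Lemma subset_config_reservoir J b : subset_config J (inr b) = 0%N.
Proof. by rewrite /subset_config sum_ffunE big1 // => i _; rewrite deltaE. Qed.

Lemma csize_subset_config J : csize (subset_config J) = #|J|.
Proof.
rewrite csize_bulk !subset_config_reservoir !addn0 /bulk.
under eq_bigr do rewrite subset_configE.
by rewrite -big_mkcond /= sum1_card card_imset.
Qed.

Lemma subset_config_confs J : confs G sigma (@dV m) (subset_config J).
Proof.
move=> _ y; rewrite subset_configE (leq_trans (leq_b1 _)) //; exact: alpha_gt0.
Qed.

Lemma prod_subset_config J (F : V -> nat -> R) : (forall y, F y 0%N = 1) ->
  \prod_y F y (subset_config J (dV y)) = \prod_(i in J) F (x i) 1%N.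
Proof.
move=> F0; rewrite -(big_imset (fun y => F y 1%N)) /=; last by move=> i j _ _; exact: x_inj.
rewrite [RHS]big_mkcond; apply: eq_bigr => y _.
by rewrite subset_configE; case: ifP.
Qed.

Lemma csub_subset_config J :
  csub (subset_config [set: 'I_n]) (subset_config J) = subset_config (~: J).
Proof.
apply/ffunP => -[y|b]; rewrite csubE ?subset_config_reservoir //.
rewrite !subset_configE; have [/imsetP[i _ ->]|yT] := boolP (y \in x @: [set: 'I_n]%SET).
  by rewrite !mem_imset // !inE; case: (i \in J).
rewrite sub0n; apply/esym/eqP; rewrite eqb0.
by apply: contra yT => /imsetP[i _ ->]; rewrite imset_f.
Qed.

Lemma subset_config_bij : set_bij [set: {set 'I_n}]
  [set zeta | confs G sigma (@dV m) zeta /\ cle zeta (subset_config [set: 'I_n])]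
  subset_config.
Proof.
split.
- move=> J _; split; first exact: subset_config_confs.
  move=> -[y|b]; last by rewrite !subset_config_reservoir.
  rewrite !subset_configE; have [/imsetP[i _ ->]|//] := boolP (y \in x @: J).
  by rewrite imset_f.
- move=> J K _ _ e; apply/setP => i; have := congr1 (fun z : config (dsite m) => z (dV (x i))) e.
  by rewrite !subset_config_site; do 2 case: (_ \in _).
- move=> zeta [_ le]; exists [set i | zeta (dV (x i)) == 1%N]%SET => //.
  apply/ffunP => -[y|b]; last first.
    by have := le (inr b); rewrite !subset_config_reservoir leqn0 => /eqP->.
  have := le (dV y); rewrite !subset_configE.
  have [/imsetP[i _ ->]|yT] := boolP (y \in x @: [set: 'I_n]%SET).
    rewrite mem_imset // inE; by case: (zeta (dV (x i))) => [|[]].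
  rewrite leqn0 => /eqP->; apply/eqP; rewrite eqb0; apply: contra yT => /imsetP[i _ ->].
  by rewrite imset_f.
Qed.

Lemma psi_sum_subset (dual : dual_process G sigma) (irw : dual_process G 0) :
  psi_sum dual irw (subset_config [set: 'I_n]) = \sum_(J : {set 'I_n})
    ((-1) ^+ #|~: J| * prob_all_L irw (subset_config (~: J))
     * prob_all_L dual (subset_config J)).
Proof.
rewrite /psi_sum (reindex_fsbig _ _ _ _ subset_config_bij) fsbig_finite; last exact: finite_finset.
rewrite (eq_bigr (fun J : {set 'I_n} => (-1) ^+ #|~: J|
   * prob_all_L irw (subset_config (~: J)) * prob_all_L dual (subset_config J))).
  apply: perm_big; apply: uniq_perm; rewrite ?fset_uniq ?index_enum_uniq // => J.
  by rewrite in_fset_set ?mem_index_enum; [exact: mem_set | exact: finite_finset].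
by move=> J _; rewrite csub_subset_config !csize_subset_config cardsT [in RHS]cardsCs finset.setCK card_ord.
Qed.

End SubsetConfigurations.

Theorem theorem5p1 (R : realType) (m : nat) (G : geometry R m) (sigma : int)
    (sigmaP : sigma \in [:: -1; 0; 1 : int])
    (omegaLR_gt0 : 0 < Num.max (omegaL G) (omegaR G)) :
  exists psi : config (dsite m) -> R,
  forall (n : nat) (x : 'I_n -> 'I_m.+1),
    (1 <= n)%N -> (n <= m.+1)%N -> injective x ->
  let xi : config (dsite m) := \sum_(i < n) delta (dV (x i)) in
  forall (dual : dual_process G sigma) (irw : dual_process G 0),
    psi xi = psi_sum dual irw xi /\
    forall thetaL thetaR : R, Theta sigma thetaL -> Theta sigma thetaR ->
    forall (bd : bd_process G sigma thetaL thetaR)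
      (mu : probability (config 'I_m.+1) R),
      stationary bd mu ->
      ('E_mu[fun eta =>
               (\prod_(i < n) ((eta (x i))%:R / (alpha G (x i))%:R
                               - profile G mu (x i)))%R])%E
      = ((thetaL - thetaR) ^+ n * psi xi)%:E.
Proof.
(* The processes are given only after [psi]: this takes the common value of [psi_sum] over all pairs
   of processes, with default 0 if there is no pair. *)
exists (fun xi => xget 0 [set v | exists (dual : dual_process G sigma)
  (irw : dual_process G 0), v = psi_sum dual irw xi]).
move=> n x _ _ x_inj xi dual irw.
have s0 : (0 : int) \in [:: -1; 0; 1 : int] by [].
have psiE : xget 0 [set v | exists (dual : dual_process G sigma)
    (irw : dual_process G 0), v = psi_sum dual irw xi] = psi_sum dual irw xi.
  case: xgetP => [_ -> [dual' [irw' ->]]|/(_ (psi_sum dual irw xi))[]]; last by exists dual, irw.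
  apply: eq_fsbigr => zeta /set_mem[Szeta _].
  rewrite (prob_all_L_unique sigmaP omegaLR_gt0 dual' dual Szeta).
  by rewrite (prob_all_L_unique s0 omegaLR_gt0 irw' irw).
rewrite psiE; split=> // thetaL thetaR tL tR bd mu mu_st.
have xiE : xi = subset_config x [set: 'I_n].
  by rewrite /subset_config; under [RHS]eq_bigl do rewrite inE.
have sE := site_fun1 (sigma%:~R : R) thetaR.
pose p y := prob_all_L irw (delta (dV y)).
pose a y (eta : config 'I_m.+1) : R := (eta y)%:R / (alpha G y)%:R.
have pa y : polybounded (a y).
  rewrite (_ : a y = fun eta => (alpha G y)%:R^-1 * (eta y)%:R).
    by apply: polyboundedZ; exact: polybounded_site.
  by apply: funext => eta; rewrite mulrC.
(* General in the family [x'] because it serves twice: for [x] itself, and for a single site in the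
   computation of the profile. *)
have dualJ k (x' : 'I_k -> 'I_m.+1) (x'_inj : injective x') (J : {set 'I_k}) eta :
    dual_fun G sigma thetaL thetaR thetaR (subset_config x' J) eta
    = \prod_(i in J) (a (x' i) eta - thetaR).
  rewrite /dual_fun !subset_config_reservoir !expr0 !mulr1.
  rewrite (prod_subset_config x'_inj J
     (F := fun y j => site_fun sigma%:~R thetaR (alpha G y) j (eta y))).
    by apply: eq_bigr => i _; exact: site_fun1.
  by move=> y; exact: site_fun0.
have meanJ k (x' : 'I_k -> 'I_m.+1) (x'_inj : injective x') (J : {set 'I_k}) :
    mean G sigma mu (fun eta => \prod_(i in J) (a (x' i) eta - thetaR))
    = (thetaL - thetaR) ^+ #|J| * prob_all_L dual (subset_config x' J).
  rewrite -(csize_subset_config x'_inj J).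
  rewrite -(mean_dual_fun sigmaP omegaLR_gt0 dual tL tR mu_st); last exact: subset_config_confs.
  by apply: eq_mean => eta _; rewrite dualJ.
have profE y : profile G mu y = thetaR + (thetaL - thetaR) * p y.
  rewrite /profile (meanE sigmaP omegaLR_gt0 tL tR mu_st (pa y)) /=.
  have x'_inj : injective (fun _ : 'I_1 => y) by move=> i j _; rewrite !ord1.
  have := meanJ _ _ x'_inj [set: 'I_1]%SET.
  rewrite cardsT card_ord expr1 (_ : subset_config _ _ = delta (dV y)); last first.
    by rewrite /subset_config (eq_bigl xpredT) ?big_ord1 // => i; rewrite inE.
  rewrite (prob_all_L_delta omegaLR_gt0 dual irw y sigmaP) -/(p y) => <-.
  rewrite -{1}(mean_cst mu_st thetaR) -(meanD sigmaP omegaLR_gt0 tL tR mu_st).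
  - apply: eq_mean => eta _; rewrite (eq_bigl xpredT) ?big_ord1 ?subrKC // => i; by rewrite inE.
  - exact: polybounded_cst.
  - by apply: polybounded_prod => i; apply: polyboundedB => //; exact: polybounded_cst.
have expand : (fun eta : config 'I_m.+1 => \prod_(i < n) ((eta (x i))%:R / (alpha G (x i))%:R
      - profile G mu (x i))) = fun eta : config 'I_m.+1 => \sum_(J : {set 'I_n})
    (\prod_(i in ~: J) - ((thetaL - thetaR) * p (x i))) * \prod_(i in J) (a (x i) eta - thetaR).
  apply: funext => eta.
  transitivity (\prod_(i < n) ((a (x i) eta - thetaR) + - ((thetaL - thetaR) * p (x i)))).
    by apply: eq_bigr => i _; rewrite profE -/(a (x i) eta); ring.
  (* [J] collects the particles for which the density centred at [thetaR] is picked; the others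
     contribute the shift of the profile, with a sign. *)
  rewrite bigA_distr; apply: eq_bigr => J _.
  rewrite (bigID (fun i => i \in J)) /= mulrC; congr (_ * _).
    by apply: eq_big => [i|i /negPf->//]; rewrite inE.
  by apply: eq_bigr => i ->.
have pJ (J : {set 'I_n}) : polybounded (fun eta : config 'I_m.+1 => \prod_(i in J) (a (x i) eta - thetaR)).
  by apply: polybounded_prod => i; apply: polyboundedB => //; exact: polybounded_cst.
rewrite expand (meanE sigmaP omegaLR_gt0 tL tR mu_st); last first.
  by apply: polybounded_sum => J; exact: polyboundedZ.
rewrite (mean_sum sigmaP omegaLR_gt0 tL tR mu_st) //; congr (_%:E).
rewrite xiE (psi_sum_subset x_inj) mulr_sumr; apply: eq_bigr => J _.
rewrite meanJ // prob_all_L_irw // subset_config_reservoir eqxx mulr1.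
rewrite (prod_subset_config x_inj (~: J) (F := fun y j => p y ^+ j)) //.
rewrite prodrN big_split /= prodr_const.
(* Of the [n] factors, [#|~: J|] come from the shifts of the profile and [#|J|] from [meanJ]. *)
rewrite (_ : (thetaL - thetaR) ^+ n = (thetaL - thetaR) ^+ #|~: J| * (thetaL - thetaR) ^+ #|J|).
  by under [in RHS]eq_bigr do rewrite expr1; ring.
by rewrite -exprD addnC cardsC card_ord.
Qed.
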